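(* For every $N$ there is $\rho_0$ such that the following holds. Let $X$ be a convex polyhedron with $N$ vertices in $\mathbb{H}^3$ of diameter $\rho>\rho_0$. Then there exists a cyclic sequence of faces $F_1,\dots,F_k$ of $X$ (indices taken mod $k$, so $F_{k+1}=F_1$), with $F_i$ sharing an edge $e_i$ with $F_{i+1}$ for each $i$, such that the sum of the exterior dihedral angles of $X$ at $e_1,\dots,e_k$ is smaller than $2\pi+12N\exp(-\rho/(2N))$, and such that the faces $F_1,\dots,F_k$ form a curve in the Gaussian image of $X$ with geodesic curvature not exceeding $3k\exp(-\rho/N)$.
   Context: Polyhedra are compact. The exterior dihedral angle at an edge is $\pi$ minus the interior dihedral angle. The Gaussian image (polar metric) of a compact convex polyhedron $X\subset\mathbb{H}^3$ is the spherical cone metric on $S^2$ with cell structure dual to that of $X$: each face of $X$ corresponds to a cone point (vertex), each edge $e$ of $X$ to a geodesic arc, joining the vertices dual to the two faces adjacent to $e$, of length the exterior dihedral angle at $e$, and each vertex of $X$ to the spherical polygon polar to its link. The curve formed by $F_1,\dots,F_k$ is the closed polygonal curve through the vertices dual to $F_1,\dots,F_k$ along the arcs dual to $e_1,\dots,e_k$. Its geodesic curvature is the sum of the contributions of the faces $F_i$, where the contribution of $F_i$ is $0$ if the lines in the plane of $F_i$ containing its two edges $e_{i-1}$ and $e_i$ are parallel or hyperparallel (do not intersect in $\mathbb{H}^3$), and is equal to the angle of intersection of these lines if they intersect. *)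

(* Defs.v *)
(* Hyperbolic 3-space is the hyperboloid model in R^{3,1}. *)
From mathcomp Require Import all_boot all_order all_algebra.
From mathcomp Require Import all_classical all_reals all_analysis.
Set Implicit Arguments.
Unset Strict Implicit.
Unset Printing Implicit Defensive.
Import Order.TTheory GRing.Theory Num.Theory.
Import numFieldNormedType.Exports.
Local Open Scope classical_set_scope.
Local Open Scope ring_scope.

Section Hyperbolic.
Context {R : realType}.
Local Notation V := 'rV[R]_4.
Implicit Types (x y p a b n : V) (X E e : set V).

(* Coordinate 0 is the timelike one. *)
Definition lorentz x y : R :=
  \sum_(i < 3) x 0 (lift ord0 i) * y 0 (lift ord0 i) - x 0 0 * y 0 0.

Definition H3 : set V := [set x | lorentz x x = -1 /\ 0 < x 0 0].

(* d(x,y) = arcosh (- <x,y>), with arcosh c = ln (c + sqrt (c^2 - 1)). *)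
Definition hdist x y : R :=
  let c := - lorentz x y in ln (c + Num.sqrt (c ^+ 2 - 1)).

Definition hdiam X : R :=
  sup [set d | exists x y, [/\ X x, X y & d = hdist x y]].

(* Angle at p between the geodesic rays from p through a and through b (a and b
   different from p): a + <a,p> p is the Lorentz-orthogonal projection of a to
   the tangent space of H3 at p, and is the direction of the ray towards a. *)
Definition hangle p a b : R :=
  let u := a + lorentz a p *: p in
  let v := b + lorentz b p *: p in
  acos (lorentz u v / (Num.sqrt (lorentz u u) * Num.sqrt (lorentz v v))).

(* Planes and closed half-spaces of H3 are given by unit spacelike vectors n;
   n points out of the half-space. *)
Definition hplane n : set V := [set x | H3 x /\ lorentz x n = 0].
Definition hhalfspace n : set V := [set x | H3 x /\ lorentz x n <= 0].

Definition convex_polyhedron X : Prop :=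
  [/\ exists s : seq V, (forall n, n \in s -> lorentz n n = 1) /\
        X = [set x | H3 x /\ forall n, n \in s -> hhalfspace n x],
      compact X &
      exists x r, [/\ H3 x, 0 < r & forall y, H3 y -> hdist x y < r -> X y]].

(* A d-dimensional totally geodesic subspace of H3 spans a (d+1)-dimensional
   linear subspace. *)
Definition has_hdim (d : nat) E : Prop :=
  exists M : 'M[R]_(d.+1, 4),
    [/\ row_free M, forall i, E (row i M) & forall x, E x -> (x <= M)%MS].

Definition supports n X E : Prop :=
  [/\ lorentz n n = 1, X `<=` hhalfspace n & E = X `&` hplane n].

Definition face_of_dim (d : nat) X E : Prop :=
  (exists n, supports n X E) /\ has_hdim d E.

Definition vertices X : set V := [set v | face_of_dim 0 X [set v]].
Definition is_edge X E : Prop := face_of_dim 1 X E.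
Definition is_face X E : Prop := face_of_dim 2 X E.

(* The edge e lies in exactly two faces; n and m are their outward unit normals,
   which are unique, so the set below has exactly one element. *)
Definition interior_dihedral X e : R :=
  xget 0 [set t | exists F G n m,
    [/\ is_face X F /\ is_face X G, F <> G, e `<=` F `&` G,
        supports n X F /\ supports m X G & t = acos (- lorentz n m)]].

Definition exterior_dihedral X e : R := pi - interior_dihedral X e.

(* The complete geodesic containing a nondegenerate segment e. *)
Definition hline e : set V :=
  [set p | H3 p /\ exists a b s t, [/\ e a, e b & p = s *: a + t *: b]].

(* Contribution to geodesic curvature of a face with distinct edges e, e'.  If
   their lines meet at p, it is the angle at p between the rays towards e and
   e', i.e. the angle of the one of the four sectors cut out by the two lines
   that contains the face; it does not depend on a and b.  If the lines do not
   meet, the set is empty and xget returns its default value 0. *)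
Definition curvature_contribution e e' : R :=
  xget 0 [set t | exists p a b,
    [/\ hline e p /\ hline e' p, e a /\ a <> p, e' b /\ b <> p
      & t = hangle p a b]].

(* A closed polygonal curve in the 1-skeleton of the Gaussian image: its i-th
   vertex is dual to F i, and the arc from there to the next vertex is dual to
   e i and has length exterior_dihedral X (e i).  Indices are cyclic (ordS and
   ord_pred are successor and predecessor mod k); the curve enters and leaves
   each vertex along two different arcs. *)
Definition gauss_curve X (k : nat) (F e : 'I_k -> set V) : Prop :=
  (0 < k)%N /\
  forall i : 'I_k,
    [/\ is_face X (F i), is_edge X (e i), F i <> F (ordS i),
        e i `<=` F i `&` F (ordS i) & e (ord_pred i) <> e i].

Definition geodesic_curvature (k : nat) (e : 'I_k -> set V) : R :=
  \sum_(i < k) curvature_contribution (e (ord_pred i)) (e i).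

End Hyperbolic.

(* Main.v *)
Require Import Defs.
From mathcomp Require Import all_boot all_order all_algebra.
From mathcomp Require Import all_classical all_reals all_analysis.
From mathcomp Require Import zify ring lra.
Import Order.TTheory GRing.Theory Num.Theory.
Import numFieldNormedType.Exports.
Local Open Scope classical_set_scope.
Local Open Scope ring_scope.
Set Implicit Arguments.
Unset Strict Implicit.
Unset Printing Implicit Defensive.

(** Why a thin polyhedron has a short curve in its Gaussian image.

    A polyhedron is the convex hull of its vertices ([hcone_cone_of]), so its
    diameter is realized by two of them ([hdiam_vertices]).  Project the [N]
    vertices to the geodesic through these two.  The projections cut the
    diameter into at most [N - 1] pieces, so some open interval of length
    [L = rho / (N - 1)] contains none of them ([axis_gap]).  Let [P] be the plane
    orthogonal to the geodesic at the midpoint of that gap, and work in a Lorentz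
    frame adapted to it ([orthonormal_frame]).  All vertices lie at distance at
    least [L / 2] from [P]; by convexity the polyhedron lies, in the projective
    model, in a tube around the geodesic of width [delta = 2 exp (- L / 2)]
    ([hcone_in_tube]).

    The polyhedron meets [P] in a small convex polygon.  The sides of this
    polygon are cut out by the faces that form the required cycle, and its corners
    by the edges of the cycle ([cycle_gauss_curve]): since no vertex lies in
    [P], every face or edge that meets [P] has vertices on both sides of [P]
    ([far_vertex]), hence has the right dimension.

    Each face of the cycle runs along the whole gap inside the tube, so it is
    almost orthogonal to [P]: up to an error of order [delta ^ 2] its unit
    normal is the Euclidean unit normal of the corresponding side of the polygon in
    the projective model ([thin_normal]).  Thus the cosine of an exterior dihedral
    angle differs by [O (delta ^ 2)] from that of an exterior angle of a
    Euclidean polygon, and the angle itself by [O (delta)]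
    ([exterior_dihedral_le]); the exterior angles of a Euclidean polygon add up to
    [2 pi] ([polygon_cycle]).

    Two consecutive edges of the cycle lie on lines that are [O (delta)] apart
    along the gap.  If these lines meet, they do so beyond the gap, where the
    distance from [P] makes the angle of order [delta ^ 2]
    ([curvature_contribution_le]).

    An edge of the cycle is determined by two vertices, so the cycle has at most
    [N ^ 2] members ([cycle_length]).  Finally [rho / (N - 1)] exceeds [rho / N]
    by a quantity that tends to infinity with [rho], which absorbs all the
    constants and the number of terms ([gap_scale]). *)

(** * The Lorentz form *)

Section Lorentz.
Variable R : realType.
Local Notation V := 'rV[R]_4.
Implicit Types (x y z n : V) (a b t : R).

Let i1 : 'I_4 := lift ord0 ord0.
Let i2 : 'I_4 := lift ord0 (lift ord0 ord0).
Let i3 : 'I_4 := lift ord0 (lift ord0 (lift ord0 ord0)).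

Lemma lorentzE x y : lorentz x y =
  x 0 i1 * y 0 i1 + x 0 i2 * y 0 i2 + x 0 i3 * y 0 i3 - x 0 0 * y 0 0.
Proof. by rewrite /lorentz !big_ord_recl big_ord0 addr0 addrA. Qed.

Lemma lorentzC x y : lorentz x y = lorentz y x.
Proof. by rewrite !lorentzE; ring. Qed.

Lemma lorentzDl x y z : lorentz (x + y) z = lorentz x z + lorentz y z.
Proof. by rewrite !lorentzE !mxE; ring. Qed.

Lemma lorentzZl a x y : lorentz (a *: x) y = a * lorentz x y.
Proof. by rewrite !lorentzE !mxE; ring. Qed.

Lemma lorentzNl x y : lorentz (- x) y = - lorentz x y.
Proof. by rewrite -scaleN1r lorentzZl mulN1r. Qed.

Lemma lorentzBl x y z : lorentz (x - y) z = lorentz x z - lorentz y z.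
Proof. by rewrite lorentzDl lorentzNl. Qed.

Lemma lorentz0l y : lorentz 0 y = 0.
Proof. by rewrite -(scale0r y) lorentzZl mul0r. Qed.

Lemma lorentzDr x y z : lorentz z (x + y) = lorentz z x + lorentz z y.
Proof. by rewrite lorentzC lorentzDl !(lorentzC z). Qed.

Lemma lorentzZr a x y : lorentz y (a *: x) = a * lorentz y x.
Proof. by rewrite lorentzC lorentzZl lorentzC. Qed.

Lemma lorentzNr x y : lorentz y (- x) = - lorentz y x.
Proof. by rewrite lorentzC lorentzNl lorentzC. Qed.

Lemma lorentzBr x y z : lorentz z (x - y) = lorentz z x - lorentz z y.
Proof. by rewrite lorentzDr lorentzNr. Qed.

Lemma lorentz0r y : lorentz y 0 = 0.
Proof. by rewrite lorentzC lorentz0l. Qed.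

Definition lorentz_lin :=
  (lorentzDl, lorentzDr, lorentzZl, lorentzZr, lorentzNl, lorentzNr,
   lorentz0l, lorentz0r).

Lemma lorentz_suml (I : Type) (r : seq I) (P : pred I) (F : I -> V) y :
  lorentz (\sum_(i <- r | P i) F i) y = \sum_(i <- r | P i) lorentz (F i) y.
Proof.
by elim/big_rec2: _ => [|i u v _ <-]; rewrite ?lorentz0l ?lorentzDl.
Qed.

Lemma row4P x y : x 0 0 = y 0 0 -> x 0 i1 = y 0 i1 -> x 0 i2 = y 0 i2 ->
  x 0 i3 = y 0 i3 -> x = y.
Proof.
move=> e0 e1 e2 e3; apply/rowP => i.
case: (unliftP ord0 i) => [j ->|->] //.
case: (unliftP ord0 j) => [k ->|->] //.
case: (unliftP ord0 k) => [l ->|->] //.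
by rewrite ord1.
Qed.

Definition future x := lorentz x x < 0 /\ 0 < x 0 0.

Lemma H3_future x : H3 x -> future x.
Proof. by case=> e x0; split=> //; rewrite e; lra. Qed.

(** The vector [y 0 0 *: x - x 0 0 *: y] has no timelike coordinate, so its
    Lorentz square is a sum of squares.  All reverse Cauchy-Schwarz
    inequalities below are instances of this one. *)
Lemma lorentz_balanced x y :
  2 * (x 0 0 * y 0 0) * lorentz x y <=
  y 0 0 ^+ 2 * lorentz x x + x 0 0 ^+ 2 * lorentz y y.
Proof.
rewrite !lorentzE -subr_ge0.
set L := (X in 0 <= X).
suff -> : L = (y 0 0 * x 0 i1 - x 0 0 * y 0 i1) ^+ 2 +
  (y 0 0 * x 0 i2 - x 0 0 * y 0 i2) ^+ 2 +
  (y 0 0 * x 0 i3 - x 0 0 * y 0 i3) ^+ 2.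
  by rewrite !addr_ge0 ?sqr_ge0.
by rewrite /L; ring.
Qed.

Lemma future_lt0 x y : future x -> future y -> lorentz x y < 0.
Proof.
move=> [x2 x0] [y2 y0]; have := lorentz_balanced x y.
have xy0 := mulr_gt0 x0 y0.
have h1 : y 0 0 ^+ 2 * lorentz x x < 0 by rewrite pmulr_rlt0 ?exprn_gt0.
have h2 : x 0 0 ^+ 2 * lorentz y y < 0 by rewrite pmulr_rlt0 ?exprn_gt0.
nra.
Qed.

Lemma H3_le x y : H3 x -> H3 y -> lorentz x y <= -1.
Proof.
move=> [x2 x0] [y2 y0]; have := lorentz_balanced x y.
have xy0 := mulr_gt0 x0 y0; have := sqr_ge0 (x 0 0 - y 0 0).
rewrite x2 y2; nra.
Qed.

Lemma future_add x y : future x -> future y -> future (x + y).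
Proof.
move=> fx fy; have := future_lt0 fx fy; case: fx fy => x2 x0 [y2 y0] xy.
split; rewrite ?mxE; last lra.
by rewrite !lorentz_lin (lorentzC y x); lra.
Qed.

Lemma future_scale a x : 0 < a -> future x -> future (a *: x).
Proof.
move=> a0 [x2 x0]; split; rewrite ?mxE; last exact: mulr_gt0.
by rewrite !lorentz_lin mulrA pmulr_rlt0 // mulr_gt0.
Qed.

Lemma future_neq0 x : future x -> x != 0.
Proof. by move=> [x2 _]; apply: contraTneq x2 => ->; rewrite lorentz0l ltxx. Qed.

(** The form is positive definite on the complement of a timelike vector, by
    [lorentz_balanced]; the lower bound also controls the timelike coordinate
    of [y]. *)
Lemma ortho_timelike_ge x y : future x -> lorentz x y = 0 ->
  - y 0 0 ^+ 2 * lorentz x x <= x 0 0 ^+ 2 * lorentz y y.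
Proof.
by move=> _ xy; have := lorentz_balanced x y; rewrite xy; lra.
Qed.

Lemma ortho_timelike_ge0 x y : future x -> lorentz x y = 0 ->
  0 <= lorentz y y.
Proof.
move=> fx xy; have := ortho_timelike_ge fx xy; case: fx => x2 x0.
have := sqr_ge0 (y 0 0); have : 0 < x 0 0 ^+ 2 by rewrite exprn_gt0.
nra.
Qed.

Lemma ortho_timelike_gt0 x y : future x -> lorentz x y = 0 -> y != 0 ->
  0 < lorentz y y.
Proof.
move=> fx xy y0; have h := ortho_timelike_ge fx xy.
rewrite lt_def (ortho_timelike_ge0 fx xy) andbT.
apply: contraNneq y0 => yy; move: h; rewrite yy mulr0.
case: fx => x2 x0 h.
have y00 : y 0 0 = 0.
  apply/eqP; rewrite -sqrf_eq0; apply/eqP.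
  by have := sqr_ge0 (y 0 0); nra.
move: yy; rewrite lorentzE y00 mulr0 subr0 -!expr2 => yy.
have := sqr_ge0 (y 0 i1); have := sqr_ge0 (y 0 i2); have := sqr_ge0 (y 0 i3).
move=> h3 h2 h1; apply/eqP; apply: row4P; rewrite mxE //;
  by apply/eqP; rewrite -sqrf_eq0; apply/eqP; lra.
Qed.

Lemma future_ortho_add x y : future x -> lorentz x y = 0 ->
  lorentz x x + lorentz y y < 0 -> future (x + y).
Proof.
move=> fx xy xyy; have h := ortho_timelike_ge fx xy; case: fx => x2 x0.
split; first by rewrite !lorentz_lin (lorentzC y x) xy; lra.
rewrite mxE ltNge; apply/negP => xy0.
have : x 0 0 ^+ 2 <= y 0 0 ^+ 2.
  by rewrite -[leRHS]sqrrN ler_sqr ?nnegrE; lra.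
have : 0 < x 0 0 ^+ 2 by rewrite exprn_gt0.
nra.
Qed.

Definition hnormalize x : V := (Num.sqrt (- lorentz x x))^-1 *: x.

Lemma hnormalize_scale_gt0 x : future x -> 0 < (Num.sqrt (- lorentz x x))^-1.
Proof. by case=> x2 _; rewrite invr_gt0 sqrtr_gt0; lra. Qed.

Lemma H3_hnormalize x : future x -> H3 (hnormalize x).
Proof.
move=> fx; have a0 := hnormalize_scale_gt0 fx.
split; last by have [] := future_scale a0 fx.
rewrite /hnormalize !lorentz_lin mulrA -expr2 exprVn sqr_sqrtr; last first.
  by case: fx; lra.
by rewrite -[X in _^-1 * X]opprK mulrN mulVf // oppr_eq0 lt_eqF //; case: fx.
Qed.

Lemma hnormalizeK x : future x -> x = Num.sqrt (- lorentz x x) *: hnormalize x.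
Proof.
move=> fx; rewrite /hnormalize scalerA mulfV ?scale1r //.
by rewrite -invr_eq0 gt_eqF // hnormalize_scale_gt0.
Qed.

Lemma hnormalize_H3 x : H3 x -> hnormalize x = x.
Proof. by case=> x2 _; rewrite /hnormalize x2 opprK sqrtr1 invr1 scale1r. Qed.

Lemma exists_ortho (r : seq V) : (size r < 4)%N ->
  exists2 y, y != 0 & forall x, x \in r -> lorentz x y = 0.
Proof.
move=> r4.
pose A : 'M[R]_(4, size r) := \matrix_(i, j)
  (if i == 0 then - (nth 0 r j) 0 i else (nth 0 r j) 0 i).
have : kermx A != 0.
  rewrite -mxrank_eq0 mxrank_ker subn_eq0 -ltnNge.
  exact: leq_ltn_trans (rank_leq_col A) r4.
case/rowV0Pn => y /sub_kermxP yA y0; exists y => // x /(nthP 0)[j jr <-].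
move/rowP/(_ (Ordinal jr)): yA; rewrite mxE [RHS]mxE => <-.
rewrite lorentzE !big_ord_recl big_ord0 !mxE /=.
by rewrite /i1 /i2 /i3; ring.
Qed.

End Lorentz.

(** * Polyhedra are spanned by their vertices *)

Lemma ltn_count (T : eqType) (a b : pred T) (r : seq T) x :
  (forall y, y \in r -> a y -> b y) -> x \in r -> b x -> ~~ a x ->
  (count a r < count b r)%N.
Proof.
move=> ab xr bx ax; rewrite -[count b r]size_filter -(count_predC a).
rewrite count_filter (eq_in_count (a2 := a)) => [|y yr] /=; last first.
  by apply/andP/idP => [[]//|ay]; split=> //; exact: ab.
rewrite -[X in (X < _)%N]addn0 ltn_add2l -has_count.
by apply/hasP; exists x; rewrite // mem_filter bx.
Qed.

Lemma seq_argmin (R : realType) (T : eqType) (F : T -> R) (r : seq T) :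
  r != [::] -> exists2 x, x \in r & forall y, y \in r -> F x <= F y.
Proof.
elim: r => [//|a [_ _|b r IH _]].
  by exists a => [|y]; rewrite inE // => /eqP ->.
have [//|x xr xmin] := IH.
have [ax|xa] := leP (F a) (F x).
  exists a => [|y]; rewrite ?mem_head // inE => /predU1P[-> //|/xmin].
  exact: le_trans.
exists x => [|y]; rewrite inE ?xr ?orbT // => /predU1P[->|/xmin //].
exact: ltW.
Qed.

Section Polyhedra.
Variable R : realType.
Local Notation V := 'rV[R]_4.
Implicit Types (x y z n : V) (s : seq V).

Definition hpoly s : set V := [set x | H3 x /\ forall n, n \in s -> hhalfspace n x].

(** The cone over the polyhedron, to which linear arguments apply;
    [hnormalize] leads back to hyperbolic space. *)
Definition hcone s x := future x /\ forall n, n \in s -> lorentz x n <= 0.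

Lemma hpoly_hcone s x : hpoly s x -> hcone s x.
Proof. by case=> /H3_future ? h; split=> // n /h[]. Qed.

Lemma hcone_hpoly s x : hcone s x -> hpoly s (hnormalize x).
Proof.
move=> [fx xs]; split=> [|n ns]; first exact: H3_hnormalize.
split; first exact: H3_hnormalize.
by rewrite lorentzZl pmulr_rle0 ?hnormalize_scale_gt0 // xs.
Qed.

(** If a constraint were active at [x], a small step along its normal would leave
    the polyhedron within the ball. *)
Lemma hpoly_interior s x r : (forall n, n \in s -> lorentz n n = 1) ->
  H3 x -> 0 < r -> (forall y, H3 y -> hdist x y < r -> hpoly s y) ->
  forall n, n \in s -> lorentz x n < 0.
Proof.
move=> s1 Hx r0 ball n ns.
have [_ /(_ n ns) [_ xn]] : hpoly s x.
  apply: ball => //; case: Hx => x2 _.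
  by rewrite /hdist x2 opprK expr1n subrr sqrtr0 addr0 ln1.
rewrite lt_neqAle xn andbT; apply/eqP => xn0.
pose E := expR (r / 2).
have E1 : 1 < E by rewrite expR_gt1; lra.
have E0 : E != 0 by rewrite gt_eqF //; lra.
pose ch := (E + E^-1) / 2; pose sh := (E - E^-1) / 2.
have iE : E^-1 < 1 by rewrite invf_lt1 //; lra.
have iE0 : 0 < E^-1 by rewrite invr_gt0; lra.
have sh0 : 0 < sh by rewrite /sh; lra.
have ch0 : 0 < ch by rewrite /ch; lra.
have chsh : ch ^+ 2 = 1 + sh ^+ 2 by rewrite /ch /sh; field.
have x2 : lorentz x x = -1 by case: Hx.
have n1 := s1 n ns.
have xy : lorentz x (ch *: x + sh *: n) = - ch.
  by rewrite !lorentz_lin x2 xn0; ring.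
have Hy : H3 (ch *: x + sh *: n).
  have yy : lorentz (ch *: x + sh *: n) (ch *: x + sh *: n) = -1.
    by rewrite !lorentz_lin (lorentzC n x) x2 xn0 n1 !expr2 in chsh *; lra.
  split=> //; apply: (proj2 (@future_ortho_add _ (ch *: x) (sh *: n) _ _ _)).
  - exact/future_scale/H3_future.
  - by rewrite !lorentz_lin xn0 !mulr0.
  - by rewrite !lorentz_lin x2 n1; nra.
have [_ /(_ n ns) [_]] : hpoly s (ch *: x + sh *: n).
  apply: ball => //; rewrite /hdist xy opprK chsh addrAC subrr add0r.
  rewrite sqrtr_sqr gtr0_norm //.
  have -> : ch + sh = E by rewrite /ch /sh; field.
  by rewrite expRK; lra.
by rewrite !lorentz_lin xn0 n1; lra.
Qed.

Lemma hpoly_H3 s : hpoly s `<=` @H3 R.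
Proof. by move=> x []. Qed.

(** A normal orthogonal to a timelike vector is spacelike, so it can be
    rescaled to a unit one. *)
Lemma supports_normalize (X : set V) x m : X `<=` @H3 R -> future x ->
  lorentz x m = 0 -> m != 0 -> (forall y, X y -> lorentz y m <= 0) ->
  exists n, supports n X [set y | X y /\ lorentz y m = 0].
Proof.
move=> XH fx xm m0 Xm; have mm := ortho_timelike_gt0 fx xm m0.
set u := lorentz m m in mm.
have a0 : 0 < (Num.sqrt u)^-1 by rewrite invr_gt0 sqrtr_gt0.
set a := _^-1 in a0.
exists (a *: m); split.
- rewrite !lorentz_lin -/u mulrA -expr2 exprVn sqr_sqrtr ?ltW // mulVf //.
  by rewrite gt_eqF.
- move=> y Xy; split; first exact: XH.
  by rewrite lorentzZr pmulr_rle0 // Xm.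
apply/seteqP; split=> y [Xy].
  by move=> ym; split=> //; split; [exact: XH|rewrite lorentzZr ym mulr0].
by case=> _ /eqP; rewrite lorentzZr mulf_eq0 gt_eqF //= => /eqP.
Qed.

Lemma compact_lorentz_bounded (X : set V) x : compact X ->
  exists B, forall y, X y -> - lorentz x y <= B.
Proof.
move=> /compact_bounded[M [_ /(_ (M + 1))]]; rewrite ltrDl ltr01 => /(_ isT) XM.
exists (\sum_(i < 4) `|x 0 i| * (M + 1)) => y /XM /= yM.
have yi i : `|y 0 i| <= M + 1.
  by apply: le_trans yM; exact: (le_bigmax (0%R)%:nng (fun i => `|y i.1 i.2|%:nng) (0, i)).
have h i : `|x 0 i * y 0 i| <= `|x 0 i| * (M + 1).
  by rewrite normrM ler_wpM2l.
rewrite lorentzE !big_ord_recl big_ord0 addr0.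
move: (h ord0) (h (lift ord0 ord0)) (h (lift ord0 (lift ord0 ord0))).
move: (h (lift ord0 (lift ord0 (lift ord0 ord0)))).
rewrite !ler_norml => /andP[? ?] /andP[? ?] /andP[? ?] /andP[? ?].
lra.
Qed.

Section Cone.
Variable s : seq V.
Hypothesis X_compact : compact (hpoly s).

(** A segment that stays in the cone until it becomes light-like would run to
    infinity in the polyhedron, which is compact. *)
Lemma hcone_exit x y : hcone s x -> lorentz x y = 0 -> y != 0 ->
  exists t n, [/\ 0 < t, t ^+ 2 * lorentz y y < - lorentz x x, n \in s &
    0 < lorentz (x + t *: y) n].
Proof.
move=> [fx xs] xy y0; apply: contrapT => noexit.
have r0 := ortho_timelike_gt0 fx xy y0.
set r := lorentz y y in r0 noexit.
have q0 : 0 < - lorentz x x by case: fx; lra.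
set q := - lorentz x x in q0 noexit.
have [B XB] := compact_lorentz_bounded x X_compact.
(* Here [e] is minus the square of a point [z] of the segment; the choice
   makes [q / sqrt e], which measures the distance from [x], exceed [B]. *)
pose e := q ^+ 2 / (B ^+ 2 + q + 1).
have D0 : 0 < B ^+ 2 + q + 1 by have := sqr_ge0 B; lra.
have e0 : 0 < e by rewrite divr_gt0 ?exprn_gt0.
have eq : e < q by rewrite ltr_pdivrMr // expr2; have := sqr_ge0 B; nra.
have eB : B ^+ 2 * e < q ^+ 2.
  by rewrite mulrA ltr_pdivrMr //; have := exprn_gt0 2 q0; nra.
pose t := Num.sqrt ((q - e) / r).
have t2 : t ^+ 2 * r = q - e.
  by rewrite sqr_sqrtr ?divfK ?gt_eqF // divr_ge0 //; lra.
have t0 : 0 < t by rewrite sqrtr_gt0 divr_gt0 //; lra.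
pose z := x + t *: y.
have xty : lorentz x (t *: y) = 0 by rewrite lorentzZr xy mulr0.
have zz : lorentz z z = - e.
  rewrite /z !lorentz_lin (lorentzC y x) xy -/r.
  by move: t2; rewrite /q expr2; lra.
have fz : future z.
  apply: future_ortho_add => //; rewrite !lorentz_lin -/r.
  by move: t2; rewrite /q expr2; lra.
have cz : hcone s z.
  split=> // n ns; rewrite leNgt; apply/negP => zn; apply: noexit.
  by exists t, n; split=> //; rewrite t2; lra.
have := XB _ (hcone_hpoly cz).
have -> : lorentz x (hnormalize z) = - (q / Num.sqrt e).
  rewrite /hnormalize zz opprK lorentzZr /z !lorentz_lin xy /q.
  by ring.
have se : 0 < Num.sqrt e by rewrite sqrtr_gt0.
rewrite opprK ler_pdivrMr // => qB.
have : q ^+ 2 <= (B * Num.sqrt e) ^+ 2 by rewrite ler_sqr ?nnegrE; lra.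
by rewrite exprMn sqr_sqrtr; lra.
Qed.

(** Moving from a point within its face, one reaches a further constraint:
    the first one hit comes before the exit of [hcone_exit], hence while the
    point is still timelike. *)
Lemma hcone_step x y : hcone s x -> lorentz x y = 0 -> y != 0 ->
  (forall n, n \in s -> lorentz x n = 0 -> lorentz y n = 0) ->
  exists t n, [/\ 0 < t, hcone s (x + t *: y), n \in s, lorentz x n != 0 &
    lorentz (x + t *: y) n = 0].
Proof.
move=> cx xy y0 tight; have [T [m [T0 Tq ms Tm]]] := hcone_exit cx xy y0.
case: (cx) => fx xs.
pose r := [seq n <- s | 0 < lorentz y n].
have mr : m \in r.
  rewrite mem_filter ms andbT; have := xs m ms.
  by move: Tm; rewrite !lorentz_lin; nra.
have [|n] := @seq_argmin R _ (fun n => - lorentz x n / lorentz y n) r.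
  by apply: contraTneq mr => ->.
rewrite mem_filter => /andP[yn ns] nmin.
have xn : lorentz x n < 0.
  rewrite lt_neqAle xs // andbT; apply: contraTneq yn => /tight -> //.
  by rewrite ltxx.
pose t := - lorentz x n / lorentz y n.
have t0 : 0 < t by rewrite divr_gt0 //; lra.
have tT : t < T.
  apply: le_lt_trans (nmin m mr) _.
  move: mr; rewrite mem_filter => /andP[ym _].
  by rewrite ltr_pdivrMr //; move: Tm; rewrite !lorentz_lin; lra.
have ty : t * lorentz y n = - lorentz x n by rewrite /t divfK // gt_eqF.
exists t, n; split=> //; last 2 first.
- by rewrite lt_eqF.
- by rewrite !lorentz_lin ty subrr.
split=> [|k ks].
  apply: future_ortho_add => //; first by rewrite lorentzZr xy mulr0.
  rewrite !lorentz_lin; have := ortho_timelike_gt0 fx xy y0 => yy.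
  suff : t * t < T ^+ 2 by nra.
  by rewrite expr2; nra.
rewrite !lorentz_lin; have [yk|yk] := leP (lorentz y k) 0.
  by have := xs k ks; nra.
have /nmin : k \in r by rewrite mem_filter yk.
by rewrite -/t ler_pdivlMr //; lra.
Qed.

Variable o : V.
Hypothesis o_interior : forall n, n \in s -> lorentz o n < 0.

(** The sum of the active normals supports the polyhedron at that point alone:
    where the sum vanishes on the polyhedron, so does each of its terms. *)
Lemma rigid_vertex x : hcone s x ->
  (forall y, lorentz x y = 0 ->
    (forall n, n \in s -> lorentz x n = 0 -> lorentz y n = 0) -> y = 0) ->
  vertices (hpoly s) (hnormalize x).
Proof.
move=> cx rigid; have [fx xs] := cx.
pose r := [seq n <- s | lorentz x n == 0].
have rP n : n \in r -> lorentz x n = 0 /\ n \in s.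
  by rewrite mem_filter => /andP[/eqP].
pose m := \sum_(n <- r) n.
have mE y : lorentz y m = \sum_(n <- r) lorentz y n.
  rewrite lorentzC lorentz_suml; apply: eq_bigr => n _; exact: lorentzC.
have xm : lorentz x m = 0.
  by rewrite mE big_seq big1 // => n /rP[].
have rn0 : r != [::].
  apply/eqP => r0; have [//|y y0 /(_ x)] := @exists_ortho R [:: x].
  rewrite mem_head => /(_ isT) xy; case/eqP: y0; apply: rigid => // n ns xn.
  have : n \in r by rewrite mem_filter xn eqxx.
  by rewrite r0.
have m0 : m != 0.
  suff : lorentz o m < 0 by apply: contraTneq => ->; rewrite lorentz0r ltxx.
  rewrite mE; case: (r) rn0 rP => // n r' _ rP.
  rewrite big_cons ltr_wnDr //; first rewrite big_seq sumr_le0 // => k kr.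
    by apply/ltW/o_interior; have [|//] := rP k; rewrite inE kr orbT.
  by apply: o_interior; have [|//] := rP n; rewrite mem_head.
split; last first.
  exists (hnormalize x); split.
  - apply: inj_row_free => v /rowP vx.
    have := future_neq0 (H3_future (H3_hnormalize fx)).
    case/rV0Pn => j xj; apply/rowP => i; rewrite ord1 mxE.
    by have /eqP := vx j; rewrite !mxE big_ord1 mulf_eq0 (negPf xj) orbF => /eqP.
  - by move=> i; rewrite row_id.
  - by move=> y -> ; exact: submx_refl.
have Xm y : hpoly s y -> lorentz y m <= 0.
  move=> [_ yX]; rewrite mE big_seq sumr_le0 // => n /rP[_ /yX []//].
have [m1] := supports_normalize (@hpoly_H3 s) fx xm m0 Xm.
set E := (X in supports m1 _ X) => Esupp; exists m1; suff <- : E = [set hnormalize x] by [].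
apply/seteqP; split=> [y [Xy ym]|_ ->]; last first.
  by split; [exact: hcone_hpoly|rewrite lorentzZl xm mulr0].
have Hy := hpoly_H3 Xy.
have yr n : n \in r -> lorentz y n = 0.
  move=> nr; move: ym; rewrite mE.
  have r0 k : k \in r -> 0 <= - lorentz y k.
    by move=> /rP[_ ks]; case: Xy => _ /(_ k ks) []; lra.
  move/eqP; rewrite -oppr_eq0 -sumrN big_seq psumr_eq0 // => /allP /(_ n nr).
  by rewrite nr oppr_eq0 => /eqP.
pose q := - lorentz x x.
have q0 : q != 0 by rewrite /q oppr_eq0 lt_eqF //; case: fx.
have /eqP : y + (lorentz y x / q) *: x = 0.
  apply: rigid => [|n ns xn].
    by rewrite !lorentz_lin (lorentzC x y) /q in q0 *; field; rewrite -oppr_eq0.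
  by rewrite !lorentz_lin xn mulr0 addr0 yr // mem_filter xn eqxx.
rewrite addr_eq0 -scaleNr => /eqP yx; set b := - _ in yx.
(* Both points lie on one ray and on the hyperboloid. *)
have b0 : 0 < b.
  have : 0 < y 0 0 by case: Hy.
  by rewrite yx mxE pmulr_lgt0 //; case: fx.
rewrite /= -(hnormalize_H3 Hy) yx /hnormalize !lorentz_lin scalerA.
rewrite mulrA -mulrN sqrtrM ?sqr_ge0 -?expr2 ?sqr_ge0 // sqrtr_sqr gtr0_norm //.
by rewrite invfM mulrC mulrA mulfV ?mul1r // gt_eqF.
Qed.

Definition cone_of (I : finType) (v : I -> V) : set V :=
  [set x | exists2 c : I -> R, (forall i, 0 <= c i) & x = \sum_i c i *: v i].

Lemma cone_of_add (I : finType) (v : I -> V) x y :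
  cone_of v x -> cone_of v y -> cone_of v (x + y).
Proof.
move=> [c c0 ->] [d d0 ->]; exists (fun i => c i + d i) => [i|].
  exact: addr_ge0.
by rewrite -big_split; apply: eq_bigr => i _; rewrite scalerDl.
Qed.

Lemma cone_of_scale (I : finType) (v : I -> V) a x :
  0 <= a -> cone_of v x -> cone_of v (a *: x).
Proof.
move=> a0 [c c0 ->]; exists (fun i => a * c i) => [i|]; first exact: mulr_ge0.
by rewrite scaler_sumr; apply: eq_bigr => i _; rewrite scalerA.
Qed.

Lemma cone_of_gen (I : finType) (v : I -> V) i : cone_of v (v i).
Proof.
exists (fun j => (j == i)%:R) => [j|]; first exact: ler0n.
by rewrite (bigD1 i) //= eqxx scale1r big1 ?addr0 // => j /negPf ->; rewrite scale0r.
Qed.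

(** Minkowski's theorem for the cone over the polyhedron.  A point that is not
    on a vertex ray can be moved in two opposite directions without leaving
    its face, until in each of them a further constraint becomes active. *)
Lemma hcone_cone_of (I : finType) (v : I -> V) :
  (forall x, vertices (hpoly s) x -> exists i, v i = x) ->
  forall x, hcone s x -> cone_of v x.
Proof.
move=> vP x; have [k] := ubnP (count (fun n => lorentz x n != 0) s).
elim: k x => // k IH x xk cx; have [fx xs] := cx.
have [[y [y0 xy tight]]|rigid] := pselect (exists y,
  [/\ y != 0, lorentz x y = 0 &
   forall n, n \in s -> lorentz x n = 0 -> lorentz y n = 0]); last first.
  rewrite (hnormalizeK fx); apply: cone_of_scale; first exact: sqrtr_ge0.
  have [|i <-] := vP (hnormalize x); last exact: cone_of_gen.
  apply: rigid_vertex => // y xy tight; apply: contrapT => /eqP y0.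
  by apply: rigid; exists y.
have move_to z : lorentz x z = 0 -> z != 0 ->
    (forall n, n \in s -> lorentz x n = 0 -> lorentz z n = 0) ->
    exists2 t, 0 < t & cone_of v (x + t *: z).
  move=> xz z0 ztight; have [t [n [t0 cz ns xn zn]]] := hcone_step cx xz z0 ztight.
  exists t => //; apply: IH => //; rewrite -ltnS; apply: leq_trans xk; rewrite ltnS.
  apply: (@ltn_count _ _ _ _ n) => //; last by rewrite zn eqxx.
  move=> m ms; apply: contra_neq => xm.
  by rewrite !lorentz_lin xm (ztight m) // mulr0 addr0.
have [t t0 ct] := move_to y xy y0 tight.
have [|||u u0 cu] := move_to (- y).
- by rewrite lorentzNr xy oppr0.
- by rewrite oppr_eq0.
- by move=> n ns xn; rewrite lorentzNl tight // oppr0.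
have -> : x = (t + u)^-1 *: (u *: (x + t *: y) + t *: (x + u *: - y)).
  by apply/rowP => i; rewrite !mxE; field; rewrite gt_eqF // addr_gt0.
apply: cone_of_scale; first by rewrite invr_ge0 ltW // addr_gt0.
by apply: cone_of_add; apply: cone_of_scale => //; exact: ltW.
Qed.

End Cone.
End Polyhedra.

(** * Convex polygons in the Euclidean plane *)

Section Planar.
Variable R : realType.
Implicit Types (a b x y t u v : R).

Lemma sin_gt0_range x : - (2 * pi) < x -> x < 2 * pi -> 0 < sin x ->
  (0 < x /\ x < pi) \/ x < - pi.
Proof.
move=> x1 x2; rewrite ltNge => sx.
have [?|xpi] := ltP x (- pi); first by right.
left; split; rewrite ltNge; apply: contra sx => hx.
  by rewrite -oppr_ge0 -sinN sin_ge0_pi //; apply/andP; split; lra.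
rewrite -[x](subrK pi) sinDpi oppr_le0 sin_ge0_pi //; apply/andP; split; lra.
Qed.

Lemma polar_exists a b : (a, b) != (0, 0) -> exists r t,
  [/\ 0 < r, 0 <= t < 2 * pi, a = r * cos t & b = r * sin t].
Proof.
move=> ab; pose r := Num.sqrt (a ^+ 2 + b ^+ 2).
have ab2 : 0 < a ^+ 2 + b ^+ 2.
  rewrite lt_def addr_ge0 ?sqr_ge0 // andbT paddr_eq0 ?sqr_ge0 // !sqrf_eq0.
  by move: ab; rewrite -pair_eqE.
have r0 : 0 < r by rewrite sqrtr_gt0.
have r2 : r ^+ 2 = a ^+ 2 + b ^+ 2 by rewrite sqr_sqrtr // ltW.
pose q := a / r.
have q1 : -1 <= q <= 1.
  rewrite -ler_norml -(@ler_sqr _ `|q| 1) ?nnegrE // expr1n real_normK ?num_real //.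
  by rewrite expr_div_n r2 ler_pdivrMr // mul1r; have := sqr_ge0 b; lra.
have [t0 tpi] := (acos_ge0 q1, acos_lepi q1); have pi0 := pi_gt0 R.
have qr : a = r * q by rewrite /q mulrC divfK // gt_eqF.
have cq : cos (acos q) = q by rewrite acosK // in_itv.
have sq : r * sin (acos q) = `|b|.
  rewrite sin_acos // -[r]gtr0_norm // -sqrtr_sqr -sqrtrM ?sqr_ge0 // -sqrtr_sqr.
  by congr Num.sqrt; rewrite mulrBr mulr1 -exprMn -qr r2; ring.
have [b0|b0] := leP 0 b.
  exists r, (acos q); split=> //; [by apply/andP; split; lra|by rewrite cq|].
  by rewrite sq ger0_norm.
exists r, (2 * pi - acos q); split=> //.
- apply/andP; split; first lra.
  suff : 0 < acos q by lra.
  rewrite lt_neqAle t0 andbT; apply: contra_eq_neq sq => <-.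
  by rewrite sin0 mulr0 eq_sym normr_eq0 lt_eqF.
- by rewrite mulr_natl addrC cosD2pi cosN cq.
- by rewrite mulr_natl addrC sinD2pi sinN mulrN sq ltr0_norm // opprK.
Qed.

Lemma sorted_enumeration (T : finType) (A : {set T}) (f : T -> R) :
  {in A &, injective f} -> exists e : seq T,
  [/\ e =i A, size e = #|A| &
   forall (x0 : T) m n, (m < n < size e)%N -> f (nth x0 e m) < f (nth x0 e n)].
Proof.
move=> finj; exists (sort (fun i j => f i <= f j) (enum A)).
have eA : sort (fun i j => f i <= f j) (enum A) =i A.
  by move=> i; rewrite mem_sort mem_enum.
split=> //; first by rewrite size_sort -cardE.
set e := sort _ _ in eA *; move=> x0 m n /andP[mn nk].
have mk := ltn_trans mn nk.
have ue : uniq e by rewrite sort_uniq enum_uniq.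
rewrite lt_neqAle; apply/andP; split.
  apply/eqP => /finj; rewrite -!eA !mem_nth // => /(_ isT isT) /eqP.
  by rewrite nth_uniq // ltn_eqF.
have tr : transitive (fun i j => f i <= f j) by move=> i j l; exact: le_trans.
have rf : reflexive (fun i j => f i <= f j) by move=> i; exact: lexx.
have se : sorted (fun i j => f i <= f j) e.
  by apply: sort_sorted => i j; exact: le_total.
by apply: (sorted_leq_nth tr rf x0 se); rewrite ?inE // ltnW.
Qed.

Section Polygon.
Variables (I : finType) (a b c : I -> R).

Let lin i x y := a i * x + b i * y.
Let det i j := a i * b j - a j * b i.

Definition feasible (B : {set I}) x y := forall i, i \in B -> lin i x y <= c i.

Hypothesis interior : exists x y, forall i, lin i x y < c i.
Hypothesis bounded : forall u v, (u, v) != (0, 0) -> exists i, 0 < lin i u v.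

(** In a minimal system, dropping the constraint [j] admits a point that
    violates it; the segment from there to the interior crosses the line of [j]
    where no other constraint is active. *)
Lemma minimal_system : exists A : {set I},
  (forall x y, feasible A x y -> forall i, lin i x y <= c i) /\
  forall j, j \in A -> exists x y,
    lin j x y = c j /\ forall i, i \in A -> i != j -> lin i x y < c i.
Proof.
pose P (B : {set I}) := `[< forall x y, feasible B x y -> forall i, lin i x y <= c i >].
have [|A /minsetP[/asboolP AP Amin]] := @ex_minset _ P.
  by exists finset.setT; apply/asboolP => x y xy i; apply: xy; rewrite finset.in_setT.
exists A; split=> // j jA.
have [ox [oy oin]] := interior.
have [x [y [xyB xyA]]] : exists x y, feasible (A :\ j) x y /\ ~ feasible A x y.
  apply: contrapT => none.
  have : P (A :\ j).
    apply/asboolP => x y xyB; apply: AP; apply: contrapT => xyA.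
    by apply: none; exists x, y.
  move/Amin/(_ (subsetDl _ _)) => Aj.
  by move: jA; rewrite -Aj !inE eqxx.
have jxy : c j < lin j x y.
  rewrite ltNge; apply/negP => jxy; apply: xyA => i iA.
  by have [->//|ij] := eqVneq i j; apply: xyB; rewrite !inE ij.
have oj := oin j.
pose t := (c j - lin j ox oy) / (lin j x y - lin j ox oy).
have d0 : 0 < lin j x y - lin j ox oy by lra.
have t0 : 0 < t by rewrite divr_gt0 //; lra.
have t1 : t < 1 by rewrite ltr_pdivrMr //; lra.
have linE i : lin i (ox + t * (x - ox)) (oy + t * (y - oy)) =
    (1 - t) * lin i ox oy + t * lin i x y by rewrite /lin; ring.
exists (ox + t * (x - ox)), (oy + t * (y - oy)); split.
  rewrite linE; transitivity (lin j ox oy + t * (lin j x y - lin j ox oy)).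
    by ring.
  by rewrite /t divfK ?gt_eqF //; ring.
move=> i iA ij; rewrite linE; have := oin i.
have : lin i x y <= c i by apply: xyB; rewrite !inE ij.
nra.
Qed.

Lemma feasible_bounded (A : {set I}) :
  (forall x y, feasible A x y -> forall i, lin i x y <= c i) ->
  forall u v, (u, v) != (0, 0) -> exists2 i, i \in A & 0 < lin i u v.
Proof.
move=> AP u v uv; apply: contrapT => none.
have Auv i : i \in A -> lin i u v <= 0.
  by move=> iA; rewrite leNgt; apply/negP => ?; apply: none; exists i.
have [l luv] := bounded uv; have [x [y oin]] := interior.
pose t := (c l - lin l x y) / lin l u v + 1.
have t0 : 0 <= t by rewrite addr_ge0 // divr_ge0 // ?ltW // subr_gt0.
have : lin l (x + t * u) (y + t * v) <= c l.
  apply: AP.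
  move=> i iA; have := Auv i iA; have := oin i.
  have -> : lin i (x + t * u) (y + t * v) = lin i x y + t * lin i u v.
    by rewrite /lin; ring.
  nra.
have -> : lin l (x + t * u) (y + t * v) = c l + lin l u v.
  rewrite /t /lin; field; exact: lt0r_neq0.
lra.
Qed.

(** A normal outside the open sector between two others is not a positive
    combination of them.  So the third constraint does not decrease from the
    meeting point of the two lines towards the private point of one of them,
    where it holds strictly; hence it holds strictly at the meeting point. *)
Lemma corner (A : {set I}) (j j' : I) :
  (forall j, j \in A -> exists x y,
    lin j x y = c j /\ forall i, i \in A -> i != j -> lin i x y < c i) ->
  j \in A -> j' \in A -> 0 < det j j' ->
  (forall l, l \in A -> ~ (0 < det j l /\ 0 < det l j')) ->
  exists x y, [/\ lin j x y = c j, lin j' x y = c j' &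
    forall l, l \in A -> l != j -> l != j' -> lin l x y < c l].
Proof.
move=> private jA j'A d0 empty.
have dn0 : det j j' != 0 by rewrite gt_eqF.
exists ((c j * b j' - c j' * b j) / det j j'), ((a j * c j' - a j' * c j) / det j j').
set x := _ / _; set y := _ / _.
have jE : lin j x y = c j by rewrite /x /y /lin /det in dn0 *; field.
have j'E : lin j' x y = c j' by rewrite /x /y /lin /det in dn0 *; field.
have jj' : j != j' by apply: contraTneq d0 => ->; rewrite /det subrr ltxx.
split=> // l lA lj lj'.
(* Cramer's rule for the normal of [l] *)
have cramer u v : det j j' * lin l u v = det l j' * lin j u v + det j l * lin j' u v.
  by rewrite /det /lin; ring.
have [zx [zy [zj zlt]]] := private j jA; have [wx [wy [wj wlt]]] := private j' j'A.
have zj' : lin j' zx zy < c j' by apply: zlt => //; rewrite eq_sym.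
have wj' : lin j wx wy < c j by apply: wlt.
have zl := zlt l lA lj; have wl := wlt l lA lj'.
have cx := cramer x y; have cz := cramer zx zy; have cw := cramer wx wy.
rewrite jE j'E in cx; rewrite zj in cz; rewrite wj in cw.
have [dl|dl] := leP (det j l) 0.
  suff : det j j' * lin l x y < det j j' * c l by rewrite ltr_pM2l.
  have : det j j' * lin l zx zy < det j j' * c l by rewrite ltr_pM2l.
  nra.
have dl' : det l j' <= 0 by rewrite leNgt; apply/negP => dl'; apply: (empty l).
suff : det j j' * lin l x y < det j j' * c l by rewrite ltr_pM2l.
have : det j j' * lin l wx wy < det j j' * c l by rewrite ltr_pM2l.
nra.
Qed.

(** The sides of a minimal system are sorted by the direction of their
    normals.  No normal lies between two consecutive ones, so [corner] applies; a
    gap of at least [pi] between consecutive directions would leave the polygon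
    unbounded.  The differences [D m] of consecutive directions are the exterior
    angles of the polygon, and they add up to one full turn. *)
Lemma polygon_cycle : exists (k : nat) (j : 'I_k -> I) (x y D : 'I_k -> R),
  [/\ (2 < k)%N /\ injective j,
      forall m, [/\ 0 < D m, D m < pi, 0 < det (j m) (j (ordS m)) &
        a (j m) * a (j (ordS m)) + b (j m) * b (j (ordS m)) =
        Num.sqrt (a (j m) ^+ 2 + b (j m) ^+ 2) *
        Num.sqrt (a (j (ordS m)) ^+ 2 + b (j (ordS m)) ^+ 2) * cos (D m)],
      forall m i, lin i (x m) (y m) <= c i,
      forall m l, lin (j l) (x m) (y m) = c (j l) <-> l = m \/ l = ordS m &
      \sum_m D m = 2 * pi].
Proof.
have [A [AP private]] := minimal_system.
have Abounded := feasible_bounded AP.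
have pi0 := pi_gt0 R.
have Anz i : i \in A -> (a i, b i) != (0, 0).
  move=> /private[x [y [ixy _]]]; have [ox [oy /(_ i)]] := interior.
  rewrite -{}ixy /lin; apply: contraTneq => -[-> ->].
  by rewrite !mul0r ltxx.
pose polar i (w : R * R) := i \in A ->
  [/\ 0 < w.1, 0 <= w.2 < 2 * pi, a i = w.1 * cos w.2 & b i = w.1 * sin w.2].
have [w wP] : {w : I -> R * R & forall i, polar i (w i)}.
  apply: (@choice _ _ polar) => i; have [iA|iA] := boolP (i \in A).
    by have [r [t rt]] := polar_exists (Anz i iA); exists (r, t).
  by exists (0, 0); rewrite /polar (negPf iA).
pose r i := (w i).1; pose th i := (w i).2.
have r0 i : i \in A -> 0 < r i by move=> /wP[].
have th0 i : i \in A -> 0 <= th i by move=> /wP[_ /andP[]].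
have th2 i : i \in A -> th i < 2 * pi by move=> /wP[_ /andP[]].
have aE i : i \in A -> a i = r i * cos (th i) by move=> /wP[].
have bE i : i \in A -> b i = r i * sin (th i) by move=> /wP[].
have detE i l : i \in A -> l \in A -> det i l = r i * r l * sin (th l - th i).
  by move=> iA lA; rewrite /det !aE ?bE // sinB; ring.
have det_gt0 i l : i \in A -> l \in A -> 0 < det i l ->
    (0 < th l - th i /\ th l - th i < pi) \/ th l - th i < - pi.
  move=> iA lA; rewrite detE // pmulr_rgt0 ?mulr_gt0 ?r0 // => s0.
  have := th0 i iA; have := th0 l lA; have := th2 i iA; have := th2 l lA.
  by move=> ? ? ? ?; apply: sin_gt0_range => //; lra.
have th_inj : {in A &, injective th}.
  move=> i l iA lA il; apply/eqP/negPn/negP => nil.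
  have [x [y [ixy /(_ l lA)]]] := private i iA.
  rewrite eq_sym nil => /(_ isT).
  have [x' [y' [lxy /(_ i iA nil)]]] := private l lA.
  rewrite -{}ixy -{}lxy /lin !aE // !bE // il.
  have := r0 i iA; have := r0 l lA.
  set C := cos _; set S := sin _ => rl ri h1 h2.
  have h3 : r i * (C * x' + S * y') < r i * (C * x + S * y) by lra.
  have h4 : r l * (C * x + S * y) < r l * (C * x' + S * y') by lra.
  rewrite !ltr_pM2l // in h3 h4.
  by have := lt_trans h3 h4; rewrite ltxx.
have [i0 i0A _] : exists2 i, i \in A & 0 < lin i 1 0.
  by apply: Abounded; rewrite -pair_eqE /= oner_eq0.
have [e [eA esize elt]] := sorted_enumeration th_inj.
pose k := (size e).-1.
have sk : size e = k.+1.
  by rewrite prednK // esize card_gt0; apply/set0Pn; exists i0.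
pose t := nth i0 e.
have tA m : (m <= k)%N -> t m \in A by move=> mk; rewrite -eA mem_nth // sk.
have tlt m n : (m < n)%N -> (n <= k)%N -> th (t m) < th (t n).
  by move=> mn nk; apply: elt; rewrite mn sk.
have tle m n : (m <= n)%N -> (n <= k)%N -> th (t m) <= th (t n).
  by rewrite leq_eqVlt => /predU1P[->//|mn nk]; exact/ltW/tlt.
have tP l : l \in A -> exists2 m, (m <= k)%N & l = t m.
  by rewrite -eA => /(nthP i0)[m]; rewrite sk => mk <-; exists m.
pose nx m := if (m < k)%N then m.+1 else 0.
pose D m := th (t (nx m)) - th (t m) + (if (m < k)%N then 0 else 2 * pi).
have nxk m : (nx m <= k)%N by rewrite /nx; case: ltnP.
have D0 m : (m <= k)%N -> 0 < D m.
  move=> mk; rewrite /D /nx; case: ltnP => km.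
    by have := @tlt m m.+1 (leqnn _) km; lra.
  have := th0 _ (tA 0 (leq0n _)); have := th2 _ (tA m mk); lra.
have Dpi m : (m <= k)%N -> D m < pi.
  move=> mk; rewrite ltNge; apply/negP => Dm.
  have [|l lA] := Abounded (- b (t m)) (a (t m)).
    have := Anz _ (tA m mk); apply: contraNneq => -[/eqP].
    by rewrite oppr_eq0 => /eqP -> ->.
  have -> : lin l (- b (t m)) (a (t m)) = det (t m) l by rewrite /lin /det; ring.
  have [n nk ->] := tP _ lA.
  have := th0 _ (tA m mk); have := th2 _ (tA m mk).
  have := th0 _ (tA n nk); have := th2 _ (tA n nk).
  move=> n2 n0 m2 m0 /det_gt0 -/(_ (tA m mk) (tA n nk)).
  move: Dm; rewrite /D /nx; case: ltnP => km Dm.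
    have := th2 _ (tA _ km); have [nm|mn] := leqP n m.
      by have := tle _ _ nm mk; lra.
    by have := tle _ _ mn nk; lra.
  have := tle _ _ (leq0n n) nk; have := tle n m (leq_trans nk km) mk; lra.
(* The last direction is followed by the first one plus a full turn, which
   sine and cosine do not see. *)
have sinD m : sin (th (t (nx m)) - th (t m)) = sin (D m).
  by rewrite /D; case: ifP => _; rewrite ?addr0 // mulr_natl sinD2pi.
have cosD m : cos (th (t (nx m)) - th (t m)) = cos (D m).
  by rewrite /D; case: ifP => _; rewrite ?addr0 // mulr_natl cosD2pi.
have det0 m : (m <= k)%N -> 0 < det (t m) (t (nx m)).
  move=> mk; rewrite detE ?tA // sinD !mulr_gt0 ?r0 ?tA //.
  by rewrite sin_gt0_pi // D0 ?Dpi.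
have empty m l : (m <= k)%N -> l \in A ->
    ~ (0 < det (t m) l /\ 0 < det l (t (nx m))).
  move=> mk lA [h1 h2]; have [n nk ln] := tP _ lA; rewrite {}ln in lA h1 h2.
  have := det_gt0 _ _ (tA _ mk) lA h1; have := det_gt0 _ _ lA (tA _ (nxk m)) h2.
  have := th0 _ (tA m mk); have := th2 _ (tA m mk); have := D0 m mk.
  have := th0 _ lA; have := th2 _ lA.
  have := th0 _ (tA _ (nxk m)); have := th2 _ (tA _ (nxk m)).
  have := Dpi _ mk; rewrite /D /nx; case: ltnP => km; last first.
    have := tle _ _ (leq0n n) nk; have := tle n m (leq_trans nk km) mk.
    by move=> *; lra.
  by have [nm|mn] := leqP n m; [have := tle _ _ nm mk|have := tle _ _ mn nk];
    move=> *; lra.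
pose j (m : 'I_k.+1) := t m.
have jS m : j (ordS m) = t (nx m).
  rewrite /j /nx /=; case: ltnP => km; first by rewrite modn_small.
  have -> : m = k :> nat by apply/eqP; rewrite eqn_leq km -ltnS ltn_ord.
  by rewrite modnn.
have jA m : j m \in A by apply: tA; rewrite -ltnS ltn_ord.
have ordk (m : 'I_k.+1) : (m <= k)%N by rewrite -ltnS.
have [p pP] : {p : 'I_k.+1 -> R * R & forall m,
    [/\ lin (j m) (p m).1 (p m).2 = c (j m),
        lin (j (ordS m)) (p m).1 (p m).2 = c (j (ordS m)) &
    forall l, l \in A -> l != j m -> l != j (ordS m) ->
      lin l (p m).1 (p m).2 < c l]}.
  apply: (@choice _ _ (fun (m : 'I_k.+1) (p : R * R) =>
    [/\ lin (j m) p.1 p.2 = c (j m),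
        lin (j (ordS m)) p.1 p.2 = c (j (ordS m)) &
    forall l, l \in A -> l != j m -> l != j (ordS m) ->
      lin l p.1 p.2 < c l])) => m.
  have [||x [y]] := @corner A (j m) (j (ordS m)) private (jA _) (jA _).
  - by rewrite jS; exact: det0.
  - by move=> l lA; rewrite jS; exact: empty.
  by exists (x, y).
have jinj : injective j.
  move=> m n mn; apply: ord_inj; case: (ltngtP m n) => // lt.
    by have := tlt m n lt (ordk n); rewrite -/(j m) mn ltxx.
  by have := tlt n m lt (ordk m); rewrite -/(j m) mn ltxx.
exists k.+1, j, (fun m => (p m).1), (fun m => (p m).2), (fun m => D m).
have sumD : \sum_(m < k.+1) D m = 2 * pi.
  rewrite big_ord_recr /= {2}/D /nx ltnn.
  under eq_bigr => m _ do rewrite /D /nx ltn_ord addr0.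
  rewrite -(big_mkord xpredT (fun m => th (t m.+1) - th (t m))).
  by rewrite telescope_sumr //; ring.
split=> //.
- split=> //; rewrite ltnS ltnNge; apply/negP => k1.
  have := D0 0 (leq0n _); have := Dpi 0 (leq0n _); move: sumD.
  case: (k) k1 D0 Dpi => [|[|//]] _ D0' Dpi'.
    by rewrite big_ord1 => *; lra.
  by rewrite !big_ord_recl big_ord0 => *; have := Dpi' 1 isT; lra.
- move=> m; split; [exact: D0|exact: Dpi|by rewrite jS; exact: det0|].
  have sq i : i \in A -> Num.sqrt (a i ^+ 2 + b i ^+ 2) = r i.
    move=> iA; rewrite aE // bE // !exprMn -mulrDr cos2Dsin2 mulr1.
    by rewrite sqrtr_sqr gtr0_norm // r0.
  by rewrite !sq // jS /= -cosD cosB !aE ?bE // -?jS //; ring.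
- move=> m i; apply: AP => l lA.
  have [h1 h2 h3] := pP m; have [->|lm] := eqVneq l (j m); first by rewrite h1.
  by have [->|lm'] := eqVneq l (j (ordS m)); [rewrite h2|exact/ltW/h3].
- move=> m l; have [h1 h2 h3] := pP m; split=> [ll|[->|->]] //.
  have [lm|lm] := eqVneq l m; first by left.
  have [lm'|lm'] := eqVneq l (ordS m); first by right.
  have := h3 _ (jA l); rewrite !(inj_eq jinj) => /(_ lm lm').
  by rewrite ll ltxx.
Qed.

End Polygon.
End Planar.

(** * Angles and gaps *)

Section Analysis.
Variable R : realType.
Implicit Types (h x c e D : R).

(** From [sin t >= t / 2] on a quarter of the range, by two half-angle
    formulas. *)
Lemma one_sub_cos_ge h : 0 <= h -> h <= pi -> h ^+ 2 / 32 <= 1 - cos h.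
Proof.
move=> h0 hpi; have pi0 := pi_gt0 R.
have cpi4 : 2^-1 <= cos (pi / 4 : R).
  have c0 : 0 <= cos (pi / 4 : R).
    by apply: cos_ge0_pihalf; apply/andP; split; lra.
  have : cos (pi / 2 : R) = 2 * cos (pi / 4) ^+ 2 - 1.
    by rewrite mulr_natl -cos_mulr2n -mulr_natl; congr cos; lra.
  rewrite cos_pihalf => c2; rewrite leNgt; apply/negP => c1.
  by move: c2; rewrite expr2; nra.
have cos4 x : 0 <= x -> x <= pi / 4 -> 2^-1 <= cos x.
  move=> x0 x1; apply: le_trans cpi4 _.
  by rewrite leNgt ltr_cos ?in_itv /= -?leNgt //; apply/andP; split; lra.
have q0 : 0 <= h / 4 by lra.
have sin4 : h / 8 <= sin (h / 4).
  have [|t] := @MVT_segment R sin cos 0 (h / 4) q0 _.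
    by apply: continuous_subspaceT => x; exact: continuous_sin.
  rewrite in_itv /= sin0 !subr0 => /andP[t0 t1] ->.
  by have := cos4 t t0; move=> /(_ _); nra.
have c4 := cos4 _ q0; have {}c4 : 2^-1 <= cos (h / 4) by apply: c4; lra.
have s2 : h / 8 <= sin (h / 2).
  have -> : h / 2 = (h / 4) *+ 2 by rewrite -mulr_natl; lra.
  by rewrite sin_mulr2n -mulr_natl; nra.
have -> : cos h = 1 - 2 * sin (h / 2) ^+ 2.
  have -> : cos h = cos ((h / 2) *+ 2) by congr cos; rewrite -mulr_natl; lra.
  by rewrite cos_mulr2n cos2sin2 -mulr_natl; ring.
by rewrite !expr2; nra.
Qed.

(** The arc cosine is Hoelder continuous of exponent one half: half-angle
    formulas reduce a difference of cosines to the case of one zero angle. *)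
Lemma acos_le_add D c e : 0 <= D -> D <= pi -> -1 <= c <= 1 -> 0 <= e ->
  cos D - c <= e ^+ 2 -> acos c <= D + 6 * e.
Proof.
move=> D0 Dpi c1 e0 De; have pi0 := pi_gt0 R.
have := acos_ge0 c1; have := acos_lepi c1.
have cE : cos (acos c) = c by rewrite acosK // in_itv.
move: cE; set E := acos c => cE Epi E0.
have [|DE] := leP E D; first lra.
have hh : (E - D) ^+ 2 / 32 <= 1 - cos (E - D) by apply: one_sub_cos_ge; lra.
suff : 1 - cos (E - D) <= cos D - cos E.
  rewrite cE => h.
  have : (E - D) ^+ 2 <= (6 * e) ^+ 2.
    by rewrite exprMn; have := sqr_ge0 e; lra.
  by rewrite ler_sqr ?nnegrE; lra.
pose p := D / 2; pose q := E / 2.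
have -> : D = p *+ 2 by rewrite -mulr_natl /p; lra.
have -> : E = q *+ 2 by rewrite -mulr_natl /q; lra.
rewrite -mulrnBl !cos_mulr2n.
have sq : 0 <= sin (q - p) by apply: sin_ge0_pi; rewrite /p /q; apply/andP; split; lra.
have sp : 0 <= sin p by apply: sin_ge0_pi; rewrite /p; apply/andP; split; lra.
have cq : 0 <= cos q by apply: cos_ge0_pihalf; rewrite /q; apply/andP; split; lra.
rewrite -subr_ge0.
have -> : cos p ^+ 2 *+ 2 - 1 - (cos q ^+ 2 *+ 2 - 1) -
    (1 - (cos (q - p) ^+ 2 *+ 2 - 1)) = 4 * (sin p * cos q * sin (q - p)).
  rewrite sinB cosB.
  have e1 : sin p ^+ 2 = 1 - cos p ^+ 2 by rewrite sin2cos2.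
  have e2 : sin q ^+ 2 = 1 - cos q ^+ 2 by rewrite sin2cos2.
  have -> : (cos q * cos p + sin q * sin p) ^+ 2 = cos q ^+ 2 * cos p ^+ 2 +
     2 * (cos q * cos p * sin q * sin p) + sin q ^+ 2 * sin p ^+ 2 by ring.
  have -> : sin p * cos q * (sin q * cos p - cos q * sin p) =
    cos q * cos p * sin q * sin p - cos q ^+ 2 * sin p ^+ 2 by ring.
  by rewrite e1 e2; ring.
by rewrite !mulr_ge0.
Qed.

(** Two of the [n.+1] values lie outside the [n] open intervals of length [l]
    that follow zero, so the others cannot meet all of these intervals. *)
Lemma pigeonhole_gap (n : nat) (T : 'I_n.+1 -> R) (l : R) iv iw : 0 < l ->
  iv != iw -> T iv <= 0 -> n%:R * l <= T iw ->
  exists2 j : nat, (j < n)%N & forall i, T i <= j%:R * l \/ j.+1%:R * l <= T i.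
Proof.
move=> l0 vw Tv Tw; apply: contrapT => full.
have [h hP] : {h : 'I_n -> 'I_n.+1 &
    forall j : 'I_n, j%:R * l < T (h j) /\ T (h j) < j.+1%:R * l}.
  apply: (@choice _ _ (fun (j : 'I_n) i => j%:R * l < T i /\ T i < j.+1%:R * l)).
  move=> j; apply: contrapT => none; apply: full; exists j => // i.
  have [|ji] := leP (T i) (j%:R * l); first by left.
  right; rewrite leNgt; apply/negP => ij; by apply: none; exists i.
have lt_neq (i j : 'I_n) : (i < j)%N -> T (h i) < T (h j).
  move=> ij; have [_ hi] := hP i; have [hj _] := hP j.
  apply: lt_trans (le_lt_trans _ hj); first exact: hi.
  by rewrite ler_pM2r // ler_nat.
have hinj : injective h.
  move=> i j hij; apply: ord_inj; case: (ltngtP i j) => // /lt_neq;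
    by rewrite hij ltxx.
have sub : (h @: finset.setT \subset ~: [set iv; iw])%SET.
  apply/fintype.subsetP => i /imsetP[j _ ->]; rewrite !inE negb_or.
  have [h1 h2] := hP j; apply/andP; split; apply/eqP => hE; rewrite hE in h1 h2.
    by have : 0 <= j%:R * l by [rewrite mulr_ge0 // ltW]; lra.
  suff : j.+1%:R * l <= n%:R * l by lra.
  by rewrite ler_pM2r // ler_nat.
have := subset_leq_card sub; rewrite card_imset // cardsT card_ord.
rewrite cardsCs finset.setCK card_ord cards2 vw.
by move: (ltn_ord iv) (ltn_ord iw) vw; rewrite -(inj_eq (@ord_inj _)); lia.
Qed.

End Analysis.

Section Axis.
Variable R : realType.
Local Notation V := 'rV[R]_4.
Implicit Types (x y v w : V).

Lemma orthonormal_frame (f0 f3 : V) : future f0 ->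
  lorentz f0 f0 = -1 -> lorentz f3 f3 = 1 -> lorentz f0 f3 = 0 ->
  exists f1 f2, [/\ lorentz f1 f1 = 1 /\ lorentz f2 f2 = 1, lorentz f1 f2 = 0,
    lorentz f0 f1 = 0 /\ lorentz f0 f2 = 0, lorentz f3 f1 = 0 /\ lorentz f3 f2 = 0 &
    forall x, x = - lorentz x f0 *: f0 + lorentz x f1 *: f1 +
      lorentz x f2 *: f2 + lorentz x f3 *: f3].
Proof.
move=> F0 f00 f33 f03.
have unit y : y != 0 -> lorentz f0 y = 0 ->
    lorentz ((Num.sqrt (lorentz y y))^-1 *: y) ((Num.sqrt (lorentz y y))^-1 *: y) = 1.
  move=> y0 /(ortho_timelike_gt0 F0) /(_ y0) yy.
  rewrite lorentzZl lorentzZr mulrA -expr2 exprVn sqr_sqrtr ?ltW // mulVf //.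
  by rewrite gt_eqF.
have [//|y1 y10 o1] := @exists_ortho R [:: f0; f3].
have f0y1 : lorentz f0 y1 = 0 by apply: o1; rewrite !inE eqxx.
have f3y1 : lorentz f3 y1 = 0 by apply: o1; rewrite !inE eqxx orbT.
have f11 := unit y1 y10 f0y1; set f1 := _ *: y1 in f11.
have f01 : lorentz f0 f1 = 0 by rewrite lorentzZr f0y1 mulr0.
have f31 : lorentz f3 f1 = 0 by rewrite lorentzZr f3y1 mulr0.
have [//|y2 y20 o2] := @exists_ortho R [:: f0; f3; f1].
have f0y2 : lorentz f0 y2 = 0 by apply: o2; rewrite !inE eqxx.
have f3y2 : lorentz f3 y2 = 0 by apply: o2; rewrite !inE eqxx !orbT.
have f1y2 : lorentz f1 y2 = 0 by apply: o2; rewrite !inE eqxx !orbT.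
have f22 := unit y2 y20 f0y2; set f2 := _ *: y2 in f22.
have f02 : lorentz f0 f2 = 0 by rewrite lorentzZr f0y2 mulr0.
have f32 : lorentz f3 f2 = 0 by rewrite lorentzZr f3y2 mulr0.
have f12 : lorentz f1 f2 = 0 by rewrite lorentzZr f1y2 mulr0.
exists f1, f2; split=> // x.
have f10 : lorentz f1 f0 = 0 by rewrite lorentzC.
have f20 : lorentz f2 f0 = 0 by rewrite lorentzC.
have f30 : lorentz f3 f0 = 0 by rewrite lorentzC.
have f21 : lorentz f2 f1 = 0 by rewrite lorentzC.
have f13 : lorentz f1 f3 = 0 by rewrite lorentzC.
have f23 : lorentz f2 f3 = 0 by rewrite lorentzC.
clearbody f1 f2.
(* The four vectors are a basis since their Gram matrix is invertible. *)
pose f (i : 'I_4) := nth 0 [:: - f0; f1; f2; f3] i.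
pose F : 'M[R]_4 := \matrix_(i, j) (nth 0 [:: f0; f1; f2; f3] i) 0 j.
pose G : 'M[R]_4 := \matrix_(i, j) (if i == 0 then - (f j) 0 i else (f j) 0 i).
have mulG (y : V) j : (y *m G) 0 j = lorentz y (f j).
  by rewrite mxE lorentzE !big_ord_recl big_ord0 !mxE /=; ring.
have FG : F *m G = 1%:M.
  apply/matrixP => i j.
  have -> : (F *m G) i j = (row i F *m G) 0 j by rewrite -row_mul [RHS]mxE.
  rewrite mulG mxE /f.
  have -> : row i F = nth 0 [:: f0; f1; f2; f3] i by apply/rowP => l; rewrite !mxE.
  case: i => -[|[|[|[|//]]]] ?; case: j => -[|[|[|[|//]]]] ? /=;
    by rewrite ?lorentzNr ?f00 ?f01 ?f02 ?f03 ?f10 ?f11 ?f12 ?f13 ?f20 ?f21 ?f22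
       ?f23 ?f30 ?f31 ?f32 ?f33 ?oppr0 ?opprK.
have [_ Gu] := mulmx1_unit FG.
apply/eqP; rewrite -subr_eq0; set r := (X in X == 0); apply/eqP.
suff rG : r *m G = 0 by rewrite -[r](mulmxK Gu) rG mul0mx.
apply/rowP => j; rewrite mulG [RHS]mxE /f /r.
case: j => -[|[|[|[|//]]]] ? /=; rewrite !lorentz_lin ?f00 ?f01 ?f02 ?f03 ?f10
  ?f11 ?f12 ?f13 ?f20 ?f21 ?f22 ?f23 ?f30 ?f31 ?f32 ?f33; ring.
Qed.

(** For a point with coordinates [A] and [B] along the unit vectors [v] and
    [g] that span the geodesic, [ln ((A + B) / (A - B))] is twice the position of
    its projection.  The frame is centred at the midpoint [f0] of a gap found by
    [pigeonhole_gap], with [f3] the direction of the geodesic; the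
    inequality says that the projection is at least half a gap away from [f0]. *)
Lemma axis_gap (n : nat) (u : 'I_n.+1 -> V) iv iw (rho : R) :
  (forall i, H3 (u i)) -> 0 < rho -> rho <= hdist (u iv) (u iw) ->
  exists f0 f3, [/\ future f0 /\ lorentz f0 f0 = -1, lorentz f3 f3 = 1,
    lorentz f0 f3 = 0,
    forall i, let q := expR (rho / n%:R) in
      (q - 1) * - lorentz (u i) f0 <= (q + 1) * `|lorentz (u i) f3| &
    lorentz (u iv) f3 < 0 /\ 0 < lorentz (u iw) f3].
Proof.
move=> Hu rho0; set v := u iv; set w := u iw.
pose C := - lorentz v w; pose S := Num.sqrt (C ^+ 2 - 1).
rewrite /hdist -/C -/S => rhoCS.
have Hv : H3 v := Hu _; have Hw : H3 w := Hu _.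
have [v2 _] := Hv; have [w2 _] := Hw.
have C1 : 1 <= C by rewrite /C; have := H3_le Hv Hw; lra.
have {}C1 : 1 < C.
  rewrite lt_neqAle C1 andbT; apply: contraTneq rhoCS => C1'.
  by rewrite /S -C1' expr1n subrr sqrtr0 addr0 ln1 -ltNge.
have S2 : S ^+ 2 = C ^+ 2 - 1 by rewrite sqr_sqrtr //; nra.
have S0 : 0 < S by rewrite sqrtr_gt0; nra.
pose g := S^-1 *: (w - C *: v).
have vw : lorentz v w = - C by rewrite /C opprK.
have vg : lorentz v g = 0 by rewrite /g !lorentz_lin vw v2; ring.
have gg : lorentz g g = 1.
  transitivity ((C ^+ 2 - 1) / S ^+ 2).
    rewrite /g !lorentz_lin (lorentzC w v) vw v2 w2; field.
    by rewrite gt_eqF.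
  by rewrite -S2 divff // expf_neq0 // gt_eqF.
have wg : lorentz w g = S.
  transitivity ((C ^+ 2 - 1) / S).
    rewrite /g !lorentz_lin (lorentzC w v) vw w2; field.
    by rewrite gt_eqF.
  by rewrite -S2 expr2 mulfK // gt_eqF.
clearbody g.
pose A i := - lorentz (u i) v; pose B i := lorentz (u i) g.
have fv := H3_future Hv.
have AB i : [/\ 0 < A i, 0 < A i + B i & 0 < A i - B i].
  have A0 : 0 < A i by rewrite /A oppr_gt0; apply: future_lt0 => //; exact: H3_future.
  have : 0 <= lorentz (u i - A i *: v - B i *: g) (u i - A i *: v - B i *: g).
    apply: (ortho_timelike_ge0 fv).
    by rewrite !lorentz_lin vg v2 /A (lorentzC v); ring.
  rewrite !lorentz_lin (lorentzC v (u i)) (lorentzC g (u i)) (lorentzC g v) vg v2 gg.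
  have [-> _] := Hu i; rewrite -/(B i) -[lorentz (u i) v]opprK -/(A i) => h.
  have AB2 : 1 <= (A i + B i) * (A i - B i) by lra.
  split=> //; nra.
pose T i := ln ((A i + B i) / (A i - B i)).
have eT i : expR (T i) * (A i - B i) = A i + B i.
  have [_ p m] := AB i; rewrite lnK ?posrE ?divr_gt0 // divfK // gt_eqF //.
have n0 : (0 < n)%N.
  rewrite lt0n; apply: contraTneq C1 => n0.
  have vwE : v = w.
    congr u; apply: ord_inj; move: (ltn_ord iv) (ltn_ord iw).
    by clear - n0; lia.
  by rewrite /C -vwE v2 opprK ltxx.
have nR : 0 < n%:R :> R by rewrite ltr0n.
pose L := rho / n%:R; have L0 : 0 < L by rewrite divr_gt0.
have L2 : 0 < 2 * L by rewrite pmulr_rgt0.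
have Tv : T iv = 0.
  by rewrite /T /A /B -/v v2 vg opprK addr0 subr0 divr1 ln1.
have Tw : n%:R * (2 * L) <= T iw.
  have -> : n%:R * (2 * L) = 2 * rho by rewrite /L; field; rewrite gt_eqF.
  rewrite -[leLHS]expRK.
  rewrite ler_ln ?posrE ?expR_gt0 ?divr_gt0 //; try by case: (AB iw).
  rewrite /A /B -/w wg (lorentzC w) vw opprK.
  have CS1 : (C + S) * (C - S) = 1 by transitivity (C ^+ 2 - S ^+ 2); [ring|rewrite S2; ring].
  have CS0 : C - S != 0 by apply: contra_eq_neq CS1 => ->; rewrite mulr0 eq_sym oner_eq0.
  have -> : (C + S) / (C - S) = (C + S) ^+ 2.
    by apply: (mulIf CS0); rewrite divfK // expr2 -mulrA CS1 mulr1.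
  have CSp : 0 < C + S by lra.
  rewrite expRM_natl ler_sqr ?nnegrE ?expR_ge0 ?(ltW CSp) //.
  by rewrite -[leRHS]lnK ?posrE // ler_expR.
have ivw : iv != iw.
  by apply: contraTneq Tw => <-; rewrite Tv -ltNge; exact: mulr_gt0 nR L2.
have [|//|j jn gap] := @pigeonhole_gap R n T (2 * L) iv iw L2 ivw.
  by rewrite Tv.
pose m := (j%:R + 2^-1) * L; pose e := expR m.
have e0 : 0 < e by exact: expR_gt0.
pose ch := (e + e^-1) / 2; pose sh := (e - e^-1) / 2.
have en : e != 0 by rewrite gt_eqF.
have chsh : ch ^+ 2 - sh ^+ 2 = 1 by rewrite /ch /sh; field.
pose f0 := ch *: v + sh *: g; pose f3 := sh *: v + ch *: g.
have Fp i : - lorentz (u i) f0 + lorentz (u i) f3 = e^-1 * (A i + B i).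
  by rewrite /f0 /f3 !lorentz_lin /A /B /ch /sh; field.
have Fm i : - lorentz (u i) f0 - lorentz (u i) f3 = e * (A i - B i).
  by rewrite /f0 /f3 !lorentz_lin /A /B /ch /sh; field.
set q := expR (rho / n%:R).
have q1 : 1 < q by rewrite expR_gt1.
have hi i : j.+1%:R * (2 * L) <= T i ->
    (q - 1) * - lorentz (u i) f0 <= (q + 1) * lorentz (u i) f3.
  rewrite -ler_expR => Ti; have [A0 p d] := AB i.
  have : e * q * e * (A i - B i) <= A i + B i.
    rewrite -eT ler_pM2r //; apply: le_trans Ti.
    rewrite /e /q -!expRD ler_expR /m -/L -[j.+1%:R]natr1; lra.
  have := Fp i; have := Fm i; set X0 := - _; set X3 := lorentz _ _ => fm fp h.
  suff : q * (X0 - X3) <= X0 + X3 by lra.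
  rewrite fm fp; have -> : q * (e * (A i - B i)) = e^-1 * (e * q * e * (A i - B i)).
    by field.
  by rewrite ler_pM2l ?invr_gt0.
have lo i : T i <= j%:R * (2 * L) ->
    (q - 1) * - lorentz (u i) f0 <= (q + 1) * - lorentz (u i) f3.
  rewrite -ler_expR => Ti; have [A0 p d] := AB i.
  have : q * (A i + B i) <= e * e * (A i - B i).
    rewrite -eT mulrA ler_pM2r //; apply: le_trans (_ : q * expR (j%:R * (2 * L)) <= _).
      by rewrite ler_pM2l // expR_gt0.
    rewrite /e /q -!expRD ler_expR /m -/L; lra.
  have := Fp i; have := Fm i; set X0 := - _; set X3 := lorentz _ _ => fm fp h.
  suff : q * (X0 + X3) <= X0 - X3 by lra.
  rewrite fm fp; have -> : e * (A i - B i) = e^-1 * (e * e * (A i - B i)).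
    by field.
  by rewrite mulrCA ler_pM2l ?invr_gt0.
have f00 : lorentz f0 f0 = -1.
  by rewrite /f0 !lorentz_lin (lorentzC g) vg v2 gg !expr2 in chsh *; lra.
have F0 : future f0.
  have ch0 : 0 < ch by rewrite /ch; have : 0 < e^-1 by [rewrite invr_gt0]; lra.
  apply: future_ortho_add; first exact: future_scale.
    by rewrite !lorentz_lin vg !mulr0.
  by rewrite !lorentz_lin v2 gg !expr2 in chsh *; lra.
have X0_gt0 i : 0 < - lorentz (u i) f0.
  by rewrite oppr_gt0 future_lt0 //; exact: H3_future.
exists f0, f3; split.
- by [].
- by rewrite /f3 !lorentz_lin (lorentzC g) vg v2 gg !expr2 in chsh *; lra.
- by rewrite /f0 /f3 !lorentz_lin (lorentzC g) vg v2 gg; ring.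
- have q10 : 0 < q + 1 by lra.
  move=> i /=; rewrite -/q; case: (gap i) => [/lo|/hi] h; apply: (le_trans h);
    rewrite ler_pM2l //; last exact: ler_norm.
  by rewrite -normrN ler_norm.
split.
- have := lo iv; rewrite Tv mulr_ge0 ?ler0n ?(ltW L2) //.
  move=> /(_ isT); have := X0_gt0 iv; nra.
- have := hi iw; rewrite (le_trans _ Tw) ?(ler_pM2r L2) ?ler_nat //.
  move=> /(_ isT); have := X0_gt0 iw; nra.
Qed.

End Axis.

(** * Geodesics and angles in hyperbolic space *)

Section Angles.
Variable R : realType.
Local Notation V := 'rV[R]_4.
Implicit Types (A B P z : V) (e : R).

Lemma circle_crossing (a b v w : R) : a ^+ 2 + b ^+ 2 < 2^-1 -> (v, w) != (0, 0) ->
  exists2 t, 0 <= t & (a + t * v) ^+ 2 + (b + t * w) ^+ 2 = 2^-1.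
Proof.
move=> ab vw; pose r := v ^+ 2 + w ^+ 2; pose p := a * v + b * w.
have r0 : 0 < r.
  rewrite lt_def addr_ge0 ?sqr_ge0 // andbT paddr_eq0 ?sqr_ge0 // !sqrf_eq0.
  by move: vw; rewrite -pair_eqE.
pose d := p ^+ 2 + r * (2^-1 - (a ^+ 2 + b ^+ 2)).
have pd : p ^+ 2 <= d by rewrite lerDl mulr_ge0 ?(ltW r0) // subr_ge0 ltW.
have d2 : Num.sqrt d ^+ 2 = d by rewrite sqr_sqrtr // (le_trans (sqr_ge0 p)).
exists ((- p + Num.sqrt d) / r).
  rewrite divr_ge0 ?(ltW r0) // addrC subr_ge0 (le_trans (ler_norm p)) //.
  by rewrite -sqrtr_sqr ler_wsqrtr.
have -> : (a + (- p + Num.sqrt d) / r * v) ^+ 2 + (b + (- p + Num.sqrt d) / r * w) ^+ 2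
   = a ^+ 2 + b ^+ 2 + (Num.sqrt d ^+ 2 - p ^+ 2) / r.
  by rewrite /p /r in r0 *; field; rewrite gt_eqF.
by rewrite d2 /d; field; rewrite gt_eqF.
Qed.

(** The numerical core of [exterior_dihedral_le]: [r] and [r'] are the lengths
    of the planar parts of two unit normals, [h], [h'] and [c], [c'] their small
    remaining coordinates, and [C] is the cosine of the planar angle. *)
Lemma cos_gap (r r' C h h' c c' d : R) : 0 <= r -> 0 <= r' -> d <= 100^-1 -> 0 <= d ->
  -1 <= C <= 1 -> r ^+ 2 <= 1 + 2 * d -> r' ^+ 2 <= 1 + 2 * d ->
  1 - 5 * d <= r ^+ 2 -> 1 - 5 * d <= r' ^+ 2 -> c ^+ 2 <= 2 * d -> c' ^+ 2 <= 2 * d ->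
  h ^+ 2 <= 5 * d -> h' ^+ 2 <= 5 * d ->
  C - (r * r' * C + h * h' - c * c') <= 25 * d.
Proof.
move=> r0 r'0 d1 d0 /andP[C1 C2] ru r'u rl r'l c2 c'2 h2 h'2.
have bnd t : 0 <= t -> t ^+ 2 <= 1 + 2 * d -> 1 - 5 * d <= t ^+ 2 ->
    1 - 5 * d <= t <= 1 + 2 * d.
  by move=> t0; rewrite expr2 => tu tl; apply/andP; split; nra.
have /andP[rl1 ru1] := bnd r r0 ru rl; have /andP[rl1' ru1'] := bnd r' r'0 r'u r'l.
have p1 : 1 - 10 * d <= r * r' by nra.
have p2 : r * r' <= 1 + 10 * d by nra.
have p3 : (1 - r * r') * C <= 10 * d by nra.
have p4 : - (h * h') <= 5 * d by have := sqr_ge0 (h + h'); rewrite !expr2 in h2 h'2 *; lra.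
have p5 : c * c' <= 2 * d by have := sqr_ge0 (c - c'); rewrite !expr2 in c2 c'2 *; lra.
lra.
Qed.

Lemma H3_ray z q (la : R) : H3 z -> H3 q -> z = la *: q -> z = q.
Proof.
move=> [zz z0] [qq q0] zE; move: zz; rewrite zE !lorentz_lin qq => la2.
have : la ^+ 2 = 1 by rewrite expr2; lra.
move/eqP; rewrite sqrf_eq1 => /orP[/eqP->|/eqP laN]; first by rewrite scale1r.
by move: z0; rewrite zE laN mxE mulN1r oppr_gt0 ltNge ltW.
Qed.

(** The form is positive definite on the complement of [P], so this is a
    Euclidean estimate: [|B - A| ^ 2 >= 2 (|A| |B| - <A, B>)]. *)
Lemma angle_small P A B e : future P -> lorentz P A = 0 -> lorentz P B = 0 ->
  0 < lorentz A A -> 0 < lorentz B B -> 0 <= e ->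
  lorentz (B - A) (B - A) <=
    2 * e ^+ 2 * (Num.sqrt (lorentz A A) * Num.sqrt (lorentz B B)) ->
  acos (lorentz A B / (Num.sqrt (lorentz A A) * Num.sqrt (lorentz B B))) <= 6 * e.
Proof.
move=> fP PA PB AA BB e0 BA.
pose a := Num.sqrt (lorentz A A); pose b := Num.sqrt (lorentz B B).
have a0 : 0 < a by rewrite sqrtr_gt0.
have b0 : 0 < b by rewrite sqrtr_gt0.
have a2 : a ^+ 2 = lorentz A A by rewrite sqr_sqrtr // ltW.
have b2 : b ^+ 2 = lorentz B B by rewrite sqr_sqrtr // ltW.
have ab0 : 0 < a * b by exact: mulr_gt0.
rewrite -/a -/b in BA *; set c := lorentz A B.
have cs t : t ^+ 2 = 1 -> 0 <= a * b + t * c.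
  move=> t2; have : 0 <= lorentz (b *: A + (t * a) *: B) (b *: A + (t * a) *: B).
    by apply: (ortho_timelike_ge0 fP); rewrite !lorentz_lin PA PB !mulr0 addr0.
  rewrite !lorentz_lin (lorentzC B A) -/c -a2 -b2.
  set S := (X in 0 <= X); have -> : S = (a * b) * (a * b * (1 + t ^+ 2) + 2 * (t * c)).
    by rewrite /S; ring.
  by rewrite pmulr_rge0 // t2; lra.
have h1 := cs 1 (expr1n _ _); have h2 := cs (-1) (sqrr_sign _ 1).
rewrite -[6 * e]add0r; apply: acos_le_add => //; first exact: pi_ge0.
  by rewrite ler_pdivlMr // ler_pdivrMr //; apply/andP; split; lra.
rewrite cos0 lerBlDr -lerBlDl ler_pdivlMr //.
move: BA; rewrite !lorentz_lin (lorentzC B A) -/c -a2 -b2.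
by have := sqr_ge0 (a - b); rewrite !expr2; lra.
Qed.

(** The orthogonal projection to the tangent space at [P], when [P] is a point of
    hyperbolic space. *)
Definition proj P z := z + lorentz z P *: P.

Lemma proj_ortho P z : H3 P -> lorentz P (proj P z) = 0.
Proof. by case=> PP _; rewrite /proj !lorentz_lin PP (lorentzC P); ring. Qed.

Lemma proj_lorentz P z : H3 P ->
  lorentz (proj P z) (proj P z) = lorentz z z + lorentz z P ^+ 2.
Proof. by case=> PP _; rewrite /proj !lorentz_lin PP (lorentzC P); ring. Qed.

(** The angle depends only on the directions of the rays, so the rays may be
    represented by vectors [z] and [w] that need not be points of the rays. *)
Lemma hangle_proj P a b z w (la mu la' mu' : R) : H3 P -> 0 < mu -> 0 < mu' ->
  a = la *: P + mu *: z -> b = la' *: P + mu' *: w ->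
  hangle P a b = acos (lorentz (proj P z) (proj P w) /
    (Num.sqrt (lorentz (proj P z) (proj P z)) *
     Num.sqrt (lorentz (proj P w) (proj P w)))).
Proof.
move=> [PP _] mu0 mu'0 aE bE.
have projE (l m : R) v : l *: P + m *: v + lorentz (l *: P + m *: v) P *: P =
    m *: proj P v.
  by apply/rowP => i; rewrite /proj !lorentz_lin PP !mxE; ring.
rewrite /hangle aE bE !projE !lorentzZl !lorentzZr !mulrA -!expr2.
rewrite (sqrtrM _ (sqr_ge0 mu)) (sqrtrM _ (sqr_ge0 mu')) !sqrtr_sqr !gtr0_norm //.
set q := Num.sqrt _; set q' := Num.sqrt _; congr acos.
rewrite [mu * q * _]mulrACA -mulf_div.
by rewrite divff ?mul1r // mulf_neq0 // gt_eqF.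
Qed.

End Angles.

(** * Dimension and cyclic order *)

Section HasDim.
Variable R : realType.
Local Notation V := 'rV[R]_4.

Lemma has_hdimI (d : nat) (E : set V) (r : 'I_d.+1 -> V) : (forall i, E (r i)) ->
  (forall c : 'I_d.+1 -> R, \sum_i c i *: r i = 0 -> forall i, c i = 0) ->
  (forall x, E x -> exists c : 'I_d.+1 -> R, x = \sum_i c i *: r i) ->
  has_hdim d E.
Proof.
move=> Er free span; pose M : 'M[R]_(d.+1, 4) := \matrix_i r i.
have mulM (v : 'rV_d.+1) : v *m M = \sum_i v 0 i *: r i.
  by rewrite mulmx_sum_row; apply: eq_bigr => i _; rewrite rowK.
exists M; split.
- apply: inj_row_free => v; rewrite mulM => /free v0.
  by apply/rowP => i; rewrite v0 mxE.
- by move=> i; rewrite rowK.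
- move=> x /span[c ->]; have -> : \sum_i c i *: r i = (\row_i c i) *m M.
    by rewrite mulM; apply: eq_bigr => i _; rewrite mxE.
  exact: submxMl.
Qed.

Lemma has_hdim_le (d d' : nat) (E E' : set V) :
  has_hdim d E -> has_hdim d' E' -> E `<=` E' -> (d <= d')%N.
Proof.
move=> [M [Mfree ME _]] [M' [M'free _ M'E]] EE'.
have : (M <= M')%MS by apply/row_subP => i; apply/M'E/EE'/ME.
by move/mxrankS; rewrite (eqP Mfree) (eqP M'free) ltnS.
Qed.

End HasDim.

Section Ordinals.

Lemma ordS_neq k (m : 'I_k) : (1 < k)%N -> ordS m != m.
Proof.
move=> k1; rewrite -(inj_eq (@ord_inj _)) /=; have := ltn_ord m.
rewrite leq_eqVlt => /predU1P[mk|mk]; last by rewrite modn_small //; lia.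
by rewrite mk modnn; lia.
Qed.

Lemma ordSS_neq k (m : 'I_k) : (2 < k)%N -> ordS (ordS m) != m.
Proof.
move=> k2; rewrite -(inj_eq (@ord_inj _)) /=; have := ltn_ord m.
rewrite leq_eqVlt => /predU1P[mk|mk].
  by rewrite mk modnn modn_small; lia.
rewrite (modn_small mk); move: mk; rewrite leq_eqVlt => /predU1P[mk|mk].
  by rewrite mk modnn; lia.
by rewrite modn_small //; lia.
Qed.

End Ordinals.

(** * The section of a thin polyhedron by the middle plane *)

Section Slab.
Variable R : realType.
Local Notation V := 'rV[R]_4.
Implicit Types (x y z n : V).

Variables f0 f1 f2 f3 : V.
Hypotheses (F0 : future f0) (f00 : lorentz f0 f0 = -1).
Hypotheses (f11 : lorentz f1 f1 = 1) (f22 : lorentz f2 f2 = 1).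
Hypothesis f12 : lorentz f1 f2 = 0.
Hypotheses (f01 : lorentz f0 f1 = 0) (f02 : lorentz f0 f2 = 0).
Hypotheses (f03 : lorentz f0 f3 = 0) (f31 : lorentz f3 f1 = 0).
Hypothesis f32 : lorentz f3 f2 = 0.
Hypothesis frameE : forall x, x = - lorentz x f0 *: f0 + lorentz x f1 *: f1 +
  lorentz x f2 *: f2 + lorentz x f3 *: f3.

Local Notation X0 x := (- lorentz x f0).
Local Notation X1 x := (lorentz x f1).
Local Notation X2 x := (lorentz x f2).
Local Notation X3 x := (lorentz x f3).

Lemma lorentz_frame x y :
  lorentz x y = X1 x * X1 y + X2 x * X2 y + X3 x * X3 y - X0 x * X0 y.
Proof.
rewrite {1}(frameE x) !lorentz_lin !(lorentzC f0, lorentzC f1, lorentzC f2, lorentzC f3).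
by rewrite mulNr; ring.
Qed.

Lemma frame_inj x y : X0 x = X0 y -> X1 x = X1 y -> X2 x = X2 y -> X3 x = X3 y ->
  x = y.
Proof. by move=> e0 e1 e2 e3; rewrite (frameE x) (frameE y) e0 e1 e2 e3. Qed.

Lemma X0_future_gt0 x : future x -> 0 < X0 x.
Proof. by move=> fx; rewrite oppr_gt0 future_lt0. Qed.

Lemma timelike_future x : lorentz x x < 0 -> 0 < X0 x -> future x.
Proof.
move=> xx x0; split=> //; rewrite ltNge; apply/negP => x00.
have : x 0 0 != 0.
  apply: contraTneq xx => x000; rewrite -leNgt lorentzE x000 mul0r subr0.
  by rewrite -!expr2 !addr_ge0 ?sqr_ge0.
rewrite neq_lt ltNge [in X in _ || X]ltNge x00 orbF => x01.
have : future (- x).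
  by split; rewrite ?mxE ?lorentzNl ?lorentzNr ?opprK // oppr_gt0 ltNge.
by move/X0_future_gt0; rewrite lorentzNl; lra.
Qed.

(** Klein coordinates of the plane orthogonal to [f3]; the vector is timelike
    only inside the unit disc. *)
Definition pt (a b : R) : V := f0 + a *: f1 + b *: f2.

Lemma pt_coord a b :
  [/\ X0 (pt a b) = 1, X1 (pt a b) = a, X2 (pt a b) = b & X3 (pt a b) = 0].
Proof.
rewrite /pt !lorentz_lin (lorentzC f1 f0) (lorentzC f2 f0) (lorentzC f2 f1).
rewrite (lorentzC f1 f3) (lorentzC f2 f3) f00 f01 f02 f03 f11 f12 f22 f31 f32.
by split; ring.
Qed.

Lemma lorentz_pt a b n : lorentz (pt a b) n = X1 n * a + X2 n * b - X0 n.
Proof. by rewrite lorentz_frame; have [-> -> -> ->] := pt_coord a b; ring. Qed.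

Lemma ptE z : X3 z = 0 -> 0 < X0 z -> z = X0 z *: pt (X1 z / X0 z) (X2 z / X0 z).
Proof.
move=> z3 z0; have [p0 p1 p2 p3] := pt_coord (X1 z / X0 z) (X2 z / X0 z).
apply: frame_inj; rewrite lorentzZl ?p1 ?p2 ?p3 ?z3 ?mulr0 //.
- by rewrite -mulrN p0 mulr1.
- by rewrite mulrC divfK // gt_eqF.
- by rewrite mulrC divfK // gt_eqF.
Qed.

Variables (s : seq V) (o : V) (I : finType) (u : I -> V) (delta : R).
Hypothesis s_unit : forall n, n \in s -> lorentz n n = 1.
Hypotheses (o_future : future o) (o_interior : forall n, n \in s -> lorentz o n < 0).
Hypothesis u_hpoly : forall i, hpoly s (u i).
Hypothesis u_span : forall x, hcone s x -> cone_of u x.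
Hypotheses (delta_gt0 : 0 < delta) (delta_small : delta <= 10^-1).
Hypothesis u_far : forall i, (1 - delta ^+ 2) * X0 (u i) ^+ 2 <= X3 (u i) ^+ 2.
Variables (il ir : I).
Hypotheses (u_left : X3 (u il) < 0) (u_right : 0 < X3 (u ir)).

Lemma delta2_small : delta ^+ 2 <= 100^-1.
Proof.
have -> : 100^-1 = (10^-1) ^+ 2 :> R by field.
by rewrite ler_sqr ?nnegrE ?invr_ge0 // ltW.
Qed.

Lemma u_future i : future (u i).
Proof. by have [] := hpoly_hcone (u_hpoly i). Qed.

Lemma u_X3_neq0 i : X3 (u i) != 0.
Proof.
apply/eqP => u3; have := u_far i; rewrite u3 expr0n /=.
have := delta2_small; have := exprn_gt0 2 (X0_future_gt0 (u_future i)).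
nra.
Qed.

(** At a vertex this holds since the vertex is a unit vector with a large
    third coordinate.  The tube is convex, being cut out by the linear
    inequalities in the directions [(a, b)]. *)
Lemma hcone_in_tube x : hcone s x -> X1 x ^+ 2 + X2 x ^+ 2 <= (delta * X0 x) ^+ 2.
Proof.
move=> cx; have x0 : 0 < X0 x by apply: X0_future_gt0; case: cx.
set a := X1 x; set b := X2 x.
pose t := Num.sqrt (a ^+ 2 + b ^+ 2).
have t0 : 0 <= t by exact: sqrtr_ge0.
have t2 : t ^+ 2 = a ^+ 2 + b ^+ 2 by rewrite sqr_sqrtr // addr_ge0 ?sqr_ge0.
have dir i : a * X1 (u i) + b * X2 (u i) <= delta * t * X0 (u i).
  have u0 := X0_future_gt0 (u_future i).
  have uu : lorentz (u i) (u i) = -1 by have [[]] := u_hpoly i.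
  move: uu; rewrite lorentz_frame -!expr2 => uu.
  have h : X1 (u i) ^+ 2 + X2 (u i) ^+ 2 <= (delta * X0 (u i)) ^+ 2.
    by have := u_far i; rewrite exprMn; lra.
  apply: (le_trans (ler_norm _)); rewrite -ler_sqr ?nnegrE ?normr_ge0 //; last first.
    by rewrite !mulr_ge0 // ltW.
  rewrite real_normK ?num_real // -mulrA mulrCA exprMn t2.
  apply: le_trans (_ : (a ^+ 2 + b ^+ 2) * (X1 (u i) ^+ 2 + X2 (u i) ^+ 2) <= _).
    by have := sqr_ge0 (a * X2 (u i) - b * X1 (u i)); rewrite !expr2; lra.
  by rewrite ler_wpM2l // addr_ge0 ?sqr_ge0.
have tt : t ^+ 2 <= delta * t * X0 x.
  suff : a * X1 x + b * X2 x <= delta * t * X0 x by rewrite t2 -/a -/b !expr2.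
  have [c c0 xE] := u_span cx.
  have sumE k : lorentz x k = \sum_i c i * lorentz (u i) k.
    by rewrite {1}xE lorentz_suml; apply: eq_bigr => i _; rewrite lorentzZl.
  rewrite !sumE -sumrN !mulr_sumr -big_split /=.
  apply: ler_sum => i _; have := ler_wpM2l (c0 i) (dir i); lra.
rewrite -t2 ler_sqr ?nnegrE ?mulr_ge0 ?(ltW delta_gt0) ?(ltW x0) //.
have [->|tn] := eqVneq t 0; first by rewrite mulr_ge0 ?(ltW delta_gt0) ?(ltW x0).
have tp : 0 < t by rewrite lt_neqAle eq_sym tn.
by rewrite -(ler_pM2l tp) -expr2; lra.
Qed.

Let lin n a b := X1 n * a + X2 n * b.

Lemma section_hcone a b : (forall n, n \in s -> lin n a b <= X0 n) ->
  a ^+ 2 + b ^+ 2 <= 2^-1 -> hcone s (pt a b).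
Proof.
move=> ab ab2; have [p0 p1 p2 p3] := pt_coord a b.
split; last by move=> n /ab; rewrite lorentz_pt /lin; lra.
apply: timelike_future; last by rewrite p0.
by rewrite lorentz_frame p0 p1 p2 p3 -!expr2; lra.
Qed.

Lemma section_thin a b : hcone s (pt a b) -> a ^+ 2 + b ^+ 2 <= delta ^+ 2.
Proof. by move/hcone_in_tube; have [-> -> -> _] := pt_coord a b; rewrite mulr1. Qed.

(** An interior point is moved into the middle plane by adding a vertex on the
    other side. *)
Lemma section_interior : exists a b,
  a ^+ 2 + b ^+ 2 <= delta ^+ 2 /\ forall n, n \in s -> lin n a b < X0 n.
Proof.
have [z [cz z3 zs]] : exists z, [/\ future z, X3 z = 0 &
    forall n, n \in s -> lorentz z n < 0].
  have us i n : n \in s -> lorentz (u i) n <= 0.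
    by move=> ns; have [_ /(_ n ns)] := hpoly_hcone (u_hpoly i).
  have comb i t : 0 < t -> X3 (u i) = - t * X3 o -> exists z, [/\ future z, X3 z = 0 &
      forall n, n \in s -> lorentz z n < 0].
    move=> t0 ti; exists (t *: o + u i); split.
    - exact/future_add/u_future/future_scale.
    - by rewrite lorentzDl lorentzZl ti; ring.
    - move=> n ns; rewrite lorentzDl lorentzZl.
      by have := us i n ns; have := o_interior ns; nra.
  have [h3|h3|h3] := ltgtP (X3 o) 0; last by exists o.
  - apply: (comb ir (X3 (u ir) / - X3 o)); first by rewrite divr_gt0 ?oppr_gt0.
    by field; rewrite lt_eqF.
  - apply: (comb il (- X3 (u il) / X3 o)); first by rewrite divr_gt0 ?oppr_gt0.
    by field; rewrite gt_eqF.
have z0 := X0_future_gt0 cz.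
have zE := ptE z3 z0; set a := _ / _ in zE; set b := (X2 z / _) in zE.
have zp : pt a b = (X0 z)^-1 *: z by rewrite {2}zE scalerA mulVf ?scale1r // gt_eqF.
have cp : hcone s (pt a b).
  rewrite zp; split=> [|n ns]; first by apply: future_scale => //; rewrite invr_gt0.
  by rewrite lorentzZl ltW // pmulr_rlt0 ?invr_gt0 // zs.
exists a, b; split=> [|n ns]; first exact: section_thin.
have : lorentz (pt a b) n < 0 by rewrite zp lorentzZl pmulr_rlt0 ?invr_gt0 // zs.
by rewrite lorentz_pt /lin; lra.
Qed.

(** A ray of the section cannot leave the tube, but it would reach the circle
    of squared radius one half, which is wider than the tube. *)
Lemma section_bounded v w : (v, w) != (0, 0) ->
  exists2 n, n \in s & 0 < lin n v w.
Proof.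
move=> vw; apply: contrapT => none; have d2 := delta2_small.
have rec n : n \in s -> lin n v w <= 0.
  by move=> ns; rewrite leNgt; apply/negP => ?; apply: none; exists n.
have [a [b [ab abs]]] := section_interior.
have [|t t0 tE] := @circle_crossing R a b v w _ vw; first lra.
have : hcone s (pt (a + t * v) (b + t * w)).
  apply: section_hcone => [n ns|]; last by rewrite tE.
  have := rec n ns; have := abs n ns; rewrite /lin.
  have -> : X1 n * (a + t * v) + X2 n * (b + t * w) =
    X1 n * a + X2 n * b + t * (X1 n * v + X2 n * w) by ring.
  nra.
by move/section_thin; rewrite tE; lra.
Qed.

(** The linear constraints alone force a point of the middle plane into the
    disc: on a segment from an interior point that left the disc, the crossing
    of the circle of squared radius one half would lie outside the tube. *)
Lemma feasible_hcone a b : (forall n, n \in s -> lin n a b <= X0 n) ->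
  hcone s (pt a b).
Proof.
move=> ab; apply: section_hcone => //; rewrite leNgt; apply/negP => ab2.
have d2 := delta2_small; have [a' [b' [ab' abs]]] := section_interior.
have [||t t0 tE] := @circle_crossing R a' b' (a - a') (b - b'); first lra.
  by apply: contraTneq ab2 => -[/subr0_eq -> /subr0_eq ->]; rewrite -leNgt; lra.
have [t1|t1] := leP t 1.
  have : hcone s (pt (a' + t * (a - a')) (b' + t * (b - b'))).
    apply: section_hcone => [n ns|]; last by rewrite tE.
    have := ab n ns; have := abs n ns; rewrite /lin.
    have -> : X1 n * (a' + t * (a - a')) + X2 n * (b' + t * (b - b')) =
      (1 - t) * (X1 n * a' + X2 n * b') + t * (X1 n * a + X2 n * b) by ring.
    nra.
  by move/section_thin; rewrite tE; lra.
(* By convexity the squared norm is below one half before the crossing. *)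
have : t * (a ^+ 2 + b ^+ 2) <= (t - 1) * (a' ^+ 2 + b' ^+ 2) + 2^-1.
  rewrite -tE -subr_ge0.
  have -> : (t - 1) * (a' ^+ 2 + b' ^+ 2) +
    ((a' + t * (a - a')) ^+ 2 + (b' + t * (b - b')) ^+ 2) - t * (a ^+ 2 + b ^+ 2) =
    t * (t - 1) * ((a - a') ^+ 2 + (b - b') ^+ 2) by ring.
  by apply: mulr_ge0; [nra|rewrite addr_ge0 ?sqr_ge0].
nra.
Qed.

(** A point of the middle plane is a combination of vertices, none of which
    lies in that plane; so vertices on both sides of it take part, and they share
    the active constraints of the point. *)
Lemma far_vertex z sg : hcone s z -> X3 z = 0 -> sg != 0 ->
  exists2 i, 0 < sg * X3 (u i) &
    forall n, n \in s -> lorentz z n = 0 -> lorentz (u i) n = 0.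
Proof.
move=> cz z3 sg0; have [c c0 zE] := u_span cz.
have z0 : 0 < X0 z by apply: X0_future_gt0; case: cz.
have sumE k : lorentz z k = \sum_i c i * lorentz (u i) k.
  by rewrite {1}zE lorentz_suml; apply: eq_bigr => i _; rewrite lorentzZl.
have sum_eq0 (g : I -> R) : (forall i, g i <= 0) -> \sum_i g i = 0 -> forall i, g i = 0.
  move=> g0 /eqP; rewrite -oppr_eq0 -sumrN psumr_eq0 => [/allP h i|i _].
    by have := h i; rewrite mem_index_enum oppr_eq0 => /(_ isT) /eqP.
  by rewrite oppr_ge0.
have [i ci ui] : exists2 i, 0 < c i & 0 < sg * X3 (u i).
  apply: contrapT => none.
  have neg i : c i * (sg * X3 (u i)) <= 0.
    have := c0 i; rewrite le_eqVlt => /predU1P[<-|ci]; first by rewrite mul0r.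
    rewrite pmulr_rle0 // leNgt; apply/negP => ui; by apply: none; exists i.
  have zero : \sum_i c i * (sg * X3 (u i)) = 0.
    transitivity (sg * X3 z); last by rewrite z3 mulr0.
    by rewrite sumE mulr_sumr; apply: eq_bigr => i _; rewrite mulrCA.
  have c00 i : c i = 0.
    have /eqP := sum_eq0 _ neg zero i; rewrite !mulf_eq0 (negPf sg0).
    by rewrite (negPf (u_X3_neq0 i)) !orbF => /eqP.
  move: z0; rewrite zE big1 ?lorentz0l ?oppr0 ?ltxx // => i _.
  by rewrite c00 scale0r.
exists i => // n ns zn; have us j : lorentz (u j) n <= 0.
  by have [_ /(_ n ns)] := hpoly_hcone (u_hpoly j).
have := sum_eq0 (fun j => c j * lorentz (u j) n).
move=> /(_ _ _ i) /eqP; rewrite mulf_eq0 gt_eqF //= => h; apply/eqP/h.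
- by move=> j; have := us j; have := c0 j; nra.
- by rewrite -sumE.
Qed.

(** * The cycle of faces through the middle plane *)

(** The point [p m] is the corner of the section at which exactly the
    constraints [j m] and [j (ordS m)] are active, and [D m] is the exterior angle
    of the polygon there. *)
Section Cycle.
Variables (k : nat) (j p : 'I_k -> V) (D : 'I_k -> R).
Hypotheses (k_gt2 : (2 < k)%N) (j_s : forall m, j m \in s).
Hypotheses (D_gt0 : forall m, 0 < D m) (D_lt_pi : forall m, D m < pi).
Hypothesis det_gt0 : forall m,
  0 < X1 (j m) * X2 (j (ordS m)) - X1 (j (ordS m)) * X2 (j m).
Hypothesis D_cos : forall m,
  X1 (j m) * X1 (j (ordS m)) + X2 (j m) * X2 (j (ordS m)) =
  Num.sqrt (X1 (j m) ^+ 2 + X2 (j m) ^+ 2) *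
  Num.sqrt (X1 (j (ordS m)) ^+ 2 + X2 (j (ordS m)) ^+ 2) * cos (D m).
Hypothesis p_hcone : forall m, hcone s (p m).
Hypotheses (p_X0 : forall m, X0 (p m) = 1) (p_X3 : forall m, X3 (p m) = 0).
Hypothesis p_tight : forall m l, lorentz (p m) (j l) = 0 <-> l = m \/ l = ordS m.

Let p_future m : future (p m). Proof. by case: (p_hcone m). Qed.
Let p_f0 m : lorentz (p m) f0 = -1. Proof. by rewrite -(p_X0 m) opprK. Qed.
Let p_l m : lorentz (p m) (j m) = 0. Proof. by apply/p_tight; left. Qed.
Let p_r m : lorentz (p m) (j (ordS m)) = 0. Proof. by apply/p_tight; right. Qed.
Let p_pred m : lorentz (p (ord_pred m)) (j m) = 0.
Proof. by apply/p_tight; right; rewrite ord_predK. Qed.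

Let p_lt0 m l : l != m -> l != ordS m -> lorentz (p m) (j l) < 0.
Proof.
move=> lm lSm; rewrite lt_neqAle; apply/andP; split; last first.
  by case: (p_hcone m) => _; apply.
by apply/eqP => /p_tight[] /eqP; apply/negP.
Qed.

Let k_gt1 : (1 < k)%N. Proof. exact: ltnW. Qed.

Let p_pred_lt0 m : lorentz (p (ord_pred m)) (j (ordS m)) < 0.
Proof.
apply: p_lt0; last by rewrite ord_predK ordS_neq.
by rewrite -(inj_eq (can_inj (@ordSK k))) ord_predK ordSS_neq.
Qed.

Let p_next_lt0 m : lorentz (p m) (j (ord_pred m)) < 0.
Proof.
apply: p_lt0; first by rewrite -(inj_eq (can_inj (@ordSK k))) ord_predK eq_sym ordS_neq.
by rewrite -(inj_eq (can_inj (@ordSK k))) ord_predK eq_sym ordSS_neq.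
Qed.

Let p_succ_lt0 m : lorentz (p (ordS m)) (j m) < 0.
Proof. by apply: p_lt0; rewrite eq_sym ?ordS_neq ?ordSS_neq. Qed.

(** The planar parts of two consecutive normals are independent, so within the
    middle plane they leave a single line. *)
Lemma corner_span m z : lorentz z (j m) = 0 -> lorentz z (j (ordS m)) = 0 ->
  X3 z = 0 -> z = X0 z *: p m.
Proof.
move=> z1 z2 z3; apply/eqP; rewrite -subr_eq0; set w := z - _.
have w0 : X0 w = 0 by rewrite /w !lorentz_lin p_f0; ring.
have w3 : X3 w = 0 by rewrite /w !lorentz_lin z3 p_X3; ring.
have w1 : lorentz w (j m) = 0 by rewrite /w !lorentz_lin z1 p_l; ring.
have w2 : lorentz w (j (ordS m)) = 0 by rewrite /w !lorentz_lin z2 p_r; ring.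
move: w1 w2; rewrite (lorentz_frame w (j m)) (lorentz_frame w (j (ordS m))).
rewrite w0 w3 !mul0r !addr0 !subr0 => w1 w2.
have d0 := lt0r_neq0 (det_gt0 m).
have e1 : X1 w = 0.
  apply: (mulIf d0); rewrite mul0r.
  transitivity (X2 (j (ordS m)) * (X1 w * X1 (j m) + X2 w * X2 (j m)) -
     X2 (j m) * (X1 w * X1 (j (ordS m)) + X2 w * X2 (j (ordS m)))); first by ring.
  by rewrite w1 w2 !mulr0 subr0.
have e2 : X2 w = 0.
  apply: (mulIf d0); rewrite mul0r.
  transitivity (X1 (j m) * (X1 w * X1 (j (ordS m)) + X2 w * X2 (j (ordS m))) -
     X1 (j (ordS m)) * (X1 w * X1 (j m) + X2 w * X2 (j m))); first by ring.
  by rewrite w1 w2 !mulr0 subr0.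
by apply/eqP/frame_inj; rewrite ?lorentz0l ?oppr0.
Qed.

Lemma edge_span m v z : lorentz z (j m) = 0 -> lorentz z (j (ordS m)) = 0 ->
  lorentz v (j m) = 0 -> lorentz v (j (ordS m)) = 0 -> X3 v != 0 ->
  exists c, z = (X3 z / X3 v) *: v + c *: p m.
Proof.
move=> z1 z2 v1 v2 v3; set a := _ / _; exists (X0 (z - a *: v)).
rewrite -corner_span; first by rewrite addrC subrK.
- by rewrite !lorentz_lin z1 v1; ring.
- by rewrite !lorentz_lin z2 v2; ring.
- by rewrite !lorentz_lin /a divfK // subrr.
Qed.

Definition cycle_face m : set V := hpoly s `&` hplane (j m).
Definition cycle_edge m : set V := cycle_face m `&` cycle_face (ordS m).

Let face_pt m l : lorentz (p m) (j l) = 0 -> cycle_face l (hnormalize (p m)).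
Proof.
move=> pl; have := hcone_hpoly (p_hcone m) => Xp; split=> //.
by split; [case: Xp|rewrite lorentzZl pl mulr0].
Qed.

Let face_vertex i l : lorentz (u i) (j l) = 0 -> cycle_face l (u i).
Proof. by move=> ul; split=> //; split=> //; case: (u_hpoly i). Qed.

Let right_vertex m : exists2 i, 0 < X3 (u i) &
  lorentz (u i) (j m) = 0 /\ lorentz (u i) (j (ordS m)) = 0.
Proof.
have [i] := far_vertex (p_hcone m) (p_X3 m) (oner_neq0 R).
rewrite mul1r => ui h; exists i => //.
by split; apply: h; rewrite // ?p_l ?p_r.
Qed.

Lemma cycle_face_supports m : supports (j m) (hpoly s) (cycle_face m).
Proof.
split=> // [|z [Hz zs]]; first exact: s_unit.
by have [] := zs _ (j_s m).
Qed.

(** Two corners and a vertex off the middle plane span the face. *)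
Lemma cycle_face_is_face m : is_face (hpoly s) (cycle_face m).
Proof.
split; first by exists (j m); exact: cycle_face_supports.
have [i ui [u1 u2]] := right_vertex m.
pose a := (Num.sqrt (- lorentz (p (ord_pred m)) (p (ord_pred m))))^-1.
pose b := (Num.sqrt (- lorentz (p m) (p m)))^-1.
have a0 : a != 0 by rewrite gt_eqF // hnormalize_scale_gt0.
have b0 : b != 0 by rewrite gt_eqF // hnormalize_scale_gt0.
apply: (@has_hdimI _ 2 _ (fun l : 'I_3 =>
  nth 0 [:: hnormalize (p (ord_pred m)); hnormalize (p m); u i] l)).
- case=> -[|[|[|//]]] ? /=; [apply: face_pt|apply: face_pt|exact: face_vertex].
    exact: p_pred.
  exact: p_l.
- move=> c; rewrite !big_ord_recl big_ord0 addr0 /= !scalerA -/a -/b => sum0.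
  set c0 := c _ in sum0; set c1 := c _ in sum0; set c2 := c _ in sum0.
  have pr n : c0 * a * lorentz (p (ord_pred m)) n + (c1 * b * lorentz (p m) n +
      c2 * lorentz (u i) n) = 0.
    by rewrite -!lorentzZl -!lorentzDl sum0 lorentz0l.
  have c20 : c2 = 0.
    have := pr f3; rewrite !p_X3 !mulr0 !add0r => /eqP.
    by rewrite mulf_eq0 (gt_eqF ui) orbF => /eqP.
  have c00 : c0 = 0.
    have := pr (j (ordS m)); rewrite p_r u2 !mulr0 !addr0 => /eqP.
    by rewrite !mulf_eq0 (negPf a0) (lt_eqF (p_pred_lt0 m)) !orbF => /eqP.
  have c10 : c1 = 0.
    have := pr f0; rewrite c20 c00 !mul0r add0r addr0 => /eqP.
    rewrite -oppr_eq0 -mulrN p_X0 mulr1 mulf_eq0 (negPf b0) orbF.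
    by move/eqP.
  case=> -[|[|[|//]]] lt.
  + by rewrite -c00; congr c; apply: val_inj.
  + by rewrite -c10; congr c; apply: val_inj.
  + by rewrite -c20; congr c; apply: val_inj.
- move=> z [_ [_ zm]].
  pose la := lorentz z (j (ordS m)) / lorentz (p (ord_pred m)) (j (ordS m)).
  have z1 : lorentz (z - la *: p (ord_pred m)) (j m) = 0.
    by rewrite lorentzBl lorentzZl zm p_pred; ring.
  have z2 : lorentz (z - la *: p (ord_pred m)) (j (ordS m)) = 0.
    by rewrite lorentzBl lorentzZl /la divfK ?lt_eqF // subrr.
  have [mu] := edge_span z1 z2 u1 u2 (u_X3_neq0 i).
  rewrite [X3 (z - _)]lorentzBl lorentzZl p_X3 mulr0 subr0 => zE.
  exists (fun l : 'I_3 => nth 0 [:: la / a; mu / b; X3 z / X3 (u i)] l).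
  rewrite !big_ord_recl big_ord0 addr0 /= !scalerA -/a -/b !divfK //.
  move/eqP: zE; rewrite subr_eq => /eqP {1}->.
  by rewrite addrC [_ *: u i + _]addrC.
Qed.

(** The sum of the two normals supports the edge, which is spanned by a corner
    and a vertex off the middle plane. *)
Lemma cycle_edge_is_edge m : is_edge (hpoly s) (cycle_edge m).
Proof.
have Xj l z : hpoly s z -> lorentz z (j l) <= 0.
  by case=> _ /(_ _ (j_s l)) [].
split.
  have w0 : j m + j (ordS m) != 0.
    have : lorentz (p (ord_pred m)) (j m + j (ordS m)) < 0.
      by rewrite lorentzDr p_pred add0r.
    by apply: contraTneq => ->; rewrite lorentz0r ltxx.
  have pw : lorentz (p m) (j m + j (ordS m)) = 0 by rewrite lorentzDr p_l p_r addr0.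
  have Xw z : hpoly s z -> lorentz z (j m + j (ordS m)) <= 0.
    by move=> Xz; rewrite lorentzDr; have := Xj m z Xz; have := Xj (ordS m) z Xz; lra.
  have [n] := supports_normalize (@hpoly_H3 _ s) (p_future m) pw w0 Xw.
  set E := (X in supports n _ X) => En; exists n; suff <- : E = cycle_edge m by [].
  apply/seteqP; split=> z.
    move=> [Xz]; rewrite lorentzDr => zw.
    have z1 := Xj m z Xz; have z2 := Xj (ordS m) z Xz; have Hz := hpoly_H3 Xz.
    by split; split=> //; split=> //; lra.
  by case=> -[Xz [_ z1]] [_ [_ z2]]; split=> //; rewrite lorentzDr z1 z2 addr0.
have [i ui [u1 u2]] := right_vertex m.
pose b := (Num.sqrt (- lorentz (p m) (p m)))^-1.
have b0 : b != 0 by rewrite gt_eqF // hnormalize_scale_gt0.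
apply: (@has_hdimI _ 1 _ (fun l : 'I_2 => nth 0 [:: hnormalize (p m); u i] l)).
- case=> -[|[|//]] ? /=; split; by [apply: face_pt|apply: face_vertex].
- move=> c; rewrite !big_ord_recl big_ord0 addr0 /= !scalerA -/b => sum0.
  set c1 := c _ in sum0; set c2 := c _ in sum0.
  have pr n : c1 * b * lorentz (p m) n + c2 * lorentz (u i) n = 0.
    by rewrite -!lorentzZl -!lorentzDl sum0 lorentz0l.
  have c20 : c2 = 0.
    have := pr f3; rewrite !p_X3 !mulr0 !add0r => /eqP.
    by rewrite mulf_eq0 (gt_eqF ui) orbF => /eqP.
  have c10 : c1 = 0.
    have := pr f0; rewrite c20 !mul0r addr0 => /eqP.
    rewrite -oppr_eq0 -mulrN p_X0 mulr1 mulf_eq0 (negPf b0) orbF.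
    by move/eqP.
  case=> -[|[|//]] lt.
  + by rewrite -c10; congr c; apply: val_inj.
  + by rewrite -c20; congr c; apply: val_inj.
- move=> z [[_ [_ z1]] [_ [_ z2]]].
  have [mu zE] := edge_span z1 z2 u1 u2 (u_X3_neq0 i).
  exists (fun l : 'I_2 => nth 0 [:: mu / b; X3 z / X3 (u i)] l).
  by rewrite !big_ord_recl big_ord0 addr0 /= !scalerA -/b !divfK // addrC.
Qed.

Lemma cycle_gauss_curve : gauss_curve (hpoly s) cycle_face cycle_edge.
Proof.
split; first exact: ltnW.
move=> m; split.
- exact: cycle_face_is_face.
- exact: cycle_edge_is_edge.
- move=> FF; have := face_pt (p_pred m); rewrite FF => -[_ [_]].
  rewrite lorentzZl => /eqP; rewrite mulf_eq0 (lt_eqF (p_pred_lt0 m)) orbF.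
  by rewrite gt_eqF // hnormalize_scale_gt0.
- by [].
- move=> ee; have : cycle_edge m (hnormalize (p (ord_pred m))).
    by rewrite -ee; split; apply: face_pt.
  case=> _ [_ [_]]; rewrite lorentzZl => /eqP.
  rewrite mulf_eq0 (lt_eqF (p_pred_lt0 m)) orbF.
  by rewrite gt_eqF // hnormalize_scale_gt0.
Qed.

(** The plane of a face through the edge [cycle_edge m] has a normal in the
    span of the two normals [j m] and [j (ordS m)]; the coefficients are
    non-negative because of the neighbouring corners, and both cannot be
    positive because the face would then be no more than the edge. *)
Lemma edge_normal m n G : is_face (hpoly s) G -> supports n (hpoly s) G ->
  cycle_edge m `<=` G -> n = j m \/ n = j (ordS m).
Proof.
move=> [_ Gdim] [n1 Xn GE] eG.
have [i ui [u1 u2]] := right_vertex m.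
have Gn z : G z -> lorentz z n = 0 by rewrite GE => -[_ []].
have pn : lorentz (p m) n = 0.
  rewrite (hnormalizeK (p_future m)) lorentzZl Gn ?mulr0 //.
  by apply: eG; split; apply: face_pt.
have un : lorentz (u i) n = 0 by apply/Gn/eG; split; apply: face_vertex.
pose d := X1 (j m) * X2 (j (ordS m)) - X1 (j (ordS m)) * X2 (j m).
have d0 : d != 0 by rewrite gt_eqF // /d det_gt0.
pose al := (X1 n * X2 (j (ordS m)) - X1 (j (ordS m)) * X2 n) / d.
pose be := (X1 (j m) * X2 n - X1 n * X2 (j m)) / d.
have nE : n = al *: j m + be *: j (ordS m).
  apply/eqP; rewrite -subr_eq0; set w := n - _.
  have w1 : X1 w = 0 by rewrite /w !lorentz_lin /al /be /d in d0 *; field.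
  have w2 : X2 w = 0 by rewrite /w !lorentz_lin /al /be /d in d0 *; field.
  have pw : lorentz (p m) w = 0.
    by rewrite /w lorentzBr lorentzDr !lorentzZr pn p_l p_r; ring.
  have uw : lorentz (u i) w = 0.
    by rewrite /w lorentzBr lorentzDr !lorentzZr un u1 u2; ring.
  have w0 : X0 w = 0 by move: pw; rewrite lorentz_frame w1 w2 p_X3 p_X0; lra.
  have w3 : X3 w = 0.
    move: uw; rewrite lorentz_frame w1 w2 w0 !mulr0 subr0 !add0r => /eqP.
    by rewrite mulf_eq0 (gt_eqF ui) /= => /eqP.
  by apply/eqP/frame_inj; rewrite ?lorentz0l ?oppr0.
have Xp l : lorentz (p l) n <= 0.
  rewrite (hnormalizeK (p_future l)) lorentzZl mulr_ge0_le0 ?sqrtr_ge0 //.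
  by have [] := Xn _ (hcone_hpoly (p_hcone l)).
have be0 : 0 <= be.
  have := Xp (ord_pred m); rewrite nE !lorentz_lin p_pred mulr0 add0r.
  by have := p_pred_lt0 m; nra.
have al0 : 0 <= al.
  have := Xp (ordS m); rewrite nE !lorentz_lin p_l mulr0 addr0.
  by have := p_succ_lt0 m; nra.
have unit_coef a l : 0 <= a -> a *: j l = n -> n = j l.
  move=> a0 an; rewrite -an; have := n1; rewrite -an !lorentz_lin s_unit // mulr1.
  rewrite -expr2 => /eqP; rewrite sqrf_eq1 => /orP[/eqP->|/eqP aN].
    by rewrite scale1r.
  by move: a0; rewrite aN oppr_ge0 leNgt ltr01.
have [al00|aln] := eqVneq al 0.
  by right; apply: (unit_coef be) => //; rewrite nE al00 scale0r add0r.
have [be00|ben] := eqVneq be 0.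
  by left; apply: (unit_coef al) => //; rewrite [RHS]nE be00 scale0r addr0.
have alp : 0 < al by rewrite lt_neqAle eq_sym aln.
have bep : 0 < be by rewrite lt_neqAle eq_sym ben.
suff : (2 <= 1)%N by [].
apply: has_hdim_le Gdim (proj2 (cycle_edge_is_edge m)) _.
move=> z Gz; have := Gn z Gz; rewrite nE !lorentz_lin.
have Xz : hpoly s z by move: Gz; rewrite GE => -[].
have z1 : lorentz z (j m) <= 0 by case: Xz => _ /(_ _ (j_s m)) [].
have z2 : lorentz z (j (ordS m)) <= 0 by case: Xz => _ /(_ _ (j_s (ordS m))) [].
have Hz := hpoly_H3 Xz.
by move=> zn; split; split=> //; split=> //; nra.
Qed.

Let normals_le1 m : -1 <= lorentz (j m) (j (ordS m)) <= 1.
Proof.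
have h1 : lorentz (p m) (j m + j (ordS m)) = 0 by rewrite lorentzDr p_l p_r addr0.
have h2 : lorentz (p m) (j m - j (ordS m)) = 0 by rewrite lorentzBr p_l p_r subr0.
have := ortho_timelike_ge0 (p_future m) h1.
have := ortho_timelike_ge0 (p_future m) h2.
rewrite !lorentz_lin !s_unit // (lorentzC _ (j m)).
by move=> *; apply/andP; split; lra.
Qed.

Lemma exterior_dihedralE m :
  exterior_dihedral (hpoly s) (cycle_edge m) = acos (lorentz (j m) (j (ordS m))).
Proof.
have c1 := normals_le1 m; set c := lorentz _ _ in c1 *.
rewrite /exterior_dihedral /interior_dihedral.
rewrite /exterior_dihedral /interior_dihedral (@xget_unique _ _ _ (acos (- c))).
- by rewrite acosN // opprB addrC subrK.
- exists (cycle_face m), (cycle_face (ordS m)), (j m), (j (ordS m)); split=> //.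
  + by split; exact: cycle_face_is_face.
  + by case: cycle_gauss_curve => _ /(_ m) [].
  + by split; exact: cycle_face_supports.
- move=> t [F [G [n [n' [[Ff Gf] FG eFG [Fn Gn] ->]]]]].
  have nn' : n <> n'.
    by case: Fn Gn => _ _ FE [_ _ GE] nn'; apply: FG; rewrite FE GE nn'.
  have eF : cycle_edge m `<=` F by move=> z /eFG[].
  have eG : cycle_edge m `<=` G by move=> z /eFG[].
  have [nE|nE] := edge_normal Ff Fn eF; have [nE'|nE'] := edge_normal Gf Gn eG.
  + by case: nn'; rewrite nE.
  + by rewrite nE nE'.
  + by rewrite nE nE' lorentzC.
  + by case: nn'; rewrite nE.
Qed.

(** The plane with normal [n] contains [z], which is close to the centre [f0] of
    the frame, and a vertex that is far away but still in the tube; so [n] is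
    almost orthogonal to [f0] and to [f3]. *)
Lemma thin_normal n z i : lorentz n n = 1 -> hcone s z -> X0 z = 1 -> X3 z = 0 ->
  lorentz z n = 0 -> lorentz (u i) n = 0 ->
  [/\ X1 n ^+ 2 + X2 n ^+ 2 <= 1 + 2 * delta ^+ 2,
      1 - 5 * delta ^+ 2 <= X1 n ^+ 2 + X2 n ^+ 2,
      X0 n ^+ 2 <= 2 * delta ^+ 2 & X3 n ^+ 2 <= 5 * delta ^+ 2].
Proof.
move=> n1 cz z0 z3 zn un; have d2 := delta2_small; have dge := sqr_ge0 delta.
have zt := hcone_in_tube cz; rewrite z0 mulr1 in zt.
have ut := hcone_in_tube (hpoly_hcone (u_hpoly i)); have uf := u_far i.
have U0 : 0 < X0 (u i) ^+ 2 by apply/exprn_gt0/X0_future_gt0/u_future.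
rewrite lorentz_frame -!expr2 in n1; rewrite lorentz_frame z0 z3 in zn.
rewrite lorentz_frame in un; rewrite exprMn in ut.
move: (X0 n) (X1 n) (X2 n) (X3 n) (X1 z) (X2 z) (X0 (u i)) (X1 (u i)) (X2 (u i))
  (X3 (u i)) (delta ^+ 2) d2 dge zt ut uf U0 n1 zn un.
move=> c a b h z1 z2 v0 v1 v2 v3 d d2 dge zt ut uf v0p n1 zn un.
have cauchy (s1 s2 t1 t2 : R) :
    (s1 * t1 + s2 * t2) ^+ 2 <= (s1 ^+ 2 + s2 ^+ 2) * (t1 ^+ 2 + t2 ^+ 2).
  by have := sqr_ge0 (s1 * t2 - s2 * t1); rewrite !expr2; lra.
set r := a ^+ 2 + b ^+ 2 in n1 *.
have r0 : 0 <= r by rewrite addr_ge0 ?sqr_ge0.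
have c2 : c ^+ 2 <= r * d.
  have -> : c = a * z1 + b * z2 by lra.
  by apply: (le_trans (cauchy _ _ _ _)); rewrite ler_wpM2l.
have w2 : (a * v1 + b * v2) ^+ 2 <= r * d * v0 ^+ 2.
  by apply: (le_trans (cauchy _ _ _ _)); rewrite -mulrA ler_wpM2l.
have hv : h ^+ 2 * v3 ^+ 2 <= 4 * r * d * v0 ^+ 2.
  have -> : h ^+ 2 * v3 ^+ 2 = (c * v0 - (a * v1 + b * v2)) ^+ 2.
    by rewrite -exprMn; congr (_ ^+ 2); lra.
  have : (c * v0) ^+ 2 <= r * d * v0 ^+ 2.
    by rewrite exprMn ler_wpM2r // sqr_ge0.
  by have := sqr_ge0 (c * v0 + (a * v1 + b * v2)); rewrite !expr2 in w2 *; lra.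
have h2 : h ^+ 2 * (1 - d) <= 4 * r * d.
  rewrite -(ler_pM2r v0p) -[h ^+ 2 * _ * _]mulrA; apply: (le_trans _ hv).
  by rewrite ler_wpM2l // sqr_ge0.
have r1 : r * (1 - d) <= 1 by have := sqr_ge0 h; lra.
have r2 : r <= 100 / 99 by nra.
have rd : r * d <= 100 / 99 * d by rewrite ler_wpM2r.
have h5 : h ^+ 2 <= 5 * d by have := sqr_ge0 h; nra.
have rle : r <= 1 + 2 * d by nra.
split=> //; first by have := sqr_ge0 c; lra.
lra.
Qed.

Lemma exterior_dihedral_le m :
  exterior_dihedral (hpoly s) (cycle_edge m) <= D m + 30 * delta.
Proof.
rewrite exterior_dihedralE.
have [i ui [u1 u2]] := right_vertex m.
have [b1 b2 b3 b4] := thin_normal (s_unit (j_s m)) (p_hcone m) (p_X0 m) (p_X3 m)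
  (p_l m) u1.
have [b1' b2' b3' b4'] := thin_normal (s_unit (j_s (ordS m))) (p_hcone m) (p_X0 m)
  (p_X3 m) (p_r m) u2.
have -> : 30 * delta = 6 * (5 * delta) by ring.
have e0 : 0 <= 5 * delta by rewrite mulr_ge0 // ltW.
apply: (acos_le_add (ltW (D_gt0 m)) (ltW (D_lt_pi m)) (normals_le1 m) e0).
rewrite lorentz_frame D_cos exprMn -[5 ^+ 2]natrX.
by apply: cos_gap; rewrite ?sqrtr_ge0 ?sqr_ge0 ?delta2_small ?cos_geN1 ?cos_le1
  ?sqr_sqrtr ?addr_ge0 ?sqr_ge0.
Qed.

(** The vectors [z] and [w] of the middle plane are [O (delta)] apart.  At a point
    [P] of the tube beyond the gap their projections have length of order
    [X0 P >= 1 / delta], while their difference projects to length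
    [O (delta ^ 2 X0 P)]. *)
Lemma thin_angle P z w : H3 P -> (1 - delta ^+ 2) * X0 P ^+ 2 <= X3 P ^+ 2 ->
  hcone s z -> X0 z = 1 -> X3 z = 0 -> hcone s w -> X0 w = 1 -> X3 w = 0 ->
  acos (lorentz (proj P z) (proj P w) /
    (Num.sqrt (lorentz (proj P z) (proj P z)) *
     Num.sqrt (lorentz (proj P w) (proj P w)))) <= 18 * delta ^+ 2.
Proof.
move=> HP P3 cz z0 z3 cw w0 w3; have [PP _] := HP.
have g0 := X0_future_gt0 (H3_future HP).
have d2 := delta2_small; have d0 : 0 < delta ^+ 2 by rewrite exprn_gt0.
have zt := hcone_in_tube cz; have wt := hcone_in_tube cw; rewrite z0 mulr1 in zt; rewrite w0 mulr1 in wt.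
have cauchy (s1 s2 t1 t2 : R) :
    (s1 * t1 + s2 * t2) ^+ 2 <= (s1 ^+ 2 + s2 ^+ 2) * (t1 ^+ 2 + t2 ^+ 2).
  by have := sqr_ge0 (s1 * t2 - s2 * t1); rewrite !expr2; lra.
have PPE := PP; rewrite lorentz_frame -!expr2 in PPE.
set d := delta ^+ 2 in d2 d0 zt wt P3 *; set g := X0 P in g0 P3 PPE.
have pt2 : X1 P ^+ 2 + X2 P ^+ 2 <= d * g ^+ 2 - 1 by lra.
have dg : 1 <= d * g ^+ 2.
  by have := sqr_ge0 (X1 P); have := sqr_ge0 (X2 P); lra.
have g2 : 0 < g ^+ 2 by rewrite exprn_gt0.
have big v : X1 v ^+ 2 + X2 v ^+ 2 <= d -> X0 v = 1 -> X3 v = 0 ->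
    (97 / 100) * g ^+ 2 <= lorentz (proj P v) (proj P v).
  move=> vt v0 v3; rewrite proj_lorentz // (lorentz_frame v v) (lorentz_frame v P).
  rewrite -/g v0 v3 !mul0r !addr0 !mul1r -!expr2.
  set q := X1 v * X1 P + X2 v * X2 P.
  have q2 : q ^+ 2 <= (d * g) ^+ 2.
    apply: (le_trans (cauchy _ _ _ _)).
    apply: le_trans (_ : d * (X1 P ^+ 2 + X2 P ^+ 2) <= _).
      by rewrite ler_wpM2r // addr_ge0 ?sqr_ge0.
    have -> : (d * g) ^+ 2 = d * (d * g ^+ 2) by ring.
    by rewrite ler_wpM2l ?(ltW d0) //; lra.
  have qd : q <= d * g.
    apply: (le_trans (ler_norm q)); rewrite -ler_sqr ?nnegrE ?normr_ge0 //.
      by rewrite real_normK ?num_real.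
    by rewrite mulr_ge0 // ltW.
  have qg : q <= g / 100 by apply: (le_trans qd); rewrite mulrC ler_pM2l.
  have : (99 / 100 * g) ^+ 2 <= (g - q) ^+ 2.
    by rewrite ler_sqr ?nnegrE; lra.
  have -> : (q - g) ^+ 2 = (g - q) ^+ 2 by ring.
  have := sqr_ge0 (X1 v); have := sqr_ge0 (X2 v); rewrite exprMn.
  have : d * g ^+ 2 <= 100^-1 * g ^+ 2 by rewrite ler_pM2r.
  have -> : (99 / 100 : R) ^+ 2 = 9801 / 10000 by field.
  lra.
have zb := big z zt z0 z3; have wb := big w wt w0 w3.
have zp : 0 < lorentz (proj P z) (proj P z) by apply: lt_le_trans zb; rewrite mulr_gt0.
have wp : 0 < lorentz (proj P w) (proj P w) by apply: lt_le_trans wb; rewrite mulr_gt0.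
have -> : 18 * d = 6 * (3 * d) by ring.
apply: (angle_small (H3_future HP)); rewrite ?proj_ortho ?zp ?wp //.
  by rewrite mulr_ge0 // ltW.
have -> : proj P w - proj P z = proj P (w - z).
  by apply/rowP => i; rewrite /proj !lorentz_lin !mxE; ring.
rewrite proj_lorentz //.
have v0 : X0 (w - z) = 0 by rewrite lorentzBl opprB; lra.
have v3 : X3 (w - z) = 0 by rewrite lorentzBl w3 z3 subrr.
have v1 : X1 (w - z) = X1 w - X1 z by rewrite lorentzBl.
have v2 : X2 (w - z) = X2 w - X2 z by rewrite lorentzBl.
have vv : X1 (w - z) ^+ 2 + X2 (w - z) ^+ 2 <= 4 * d.
  rewrite v1 v2; have := sqr_ge0 (X1 w + X1 z); have := sqr_ge0 (X2 w + X2 z).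
  by rewrite !expr2 in zt wt *; lra.
rewrite (lorentz_frame (w - z) (w - z)) (lorentz_frame (w - z) P) v0 v3.
rewrite !mul0r !addr0 !subr0 -!expr2.
have vP : (X1 (w - z) * X1 P + X2 (w - z) * X2 P) ^+ 2 <= 4 * d * (d * g ^+ 2).
  apply: (le_trans (cauchy _ _ _ _)).
  apply: ler_pM; rewrite ?addr_ge0 ?sqr_ge0 //; lra.
have ab : 97 / 100 * g ^+ 2 <= Num.sqrt (lorentz (proj P z) (proj P z)) *
    Num.sqrt (lorentz (proj P w) (proj P w)).
  have c0 : 0 <= 97 / 100 * g ^+ 2 by rewrite mulr_ge0 // ltW.
  rewrite -[leLHS]sqr_sqrtr // expr2; apply: ler_pM; rewrite ?sqrtr_ge0 //;
    exact: ler_wsqrtr.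
have e2 : 0 <= 2 * (3 * d) ^+ 2 by rewrite mulr_ge0 // sqr_ge0.
apply: le_trans (ler_wpM2l e2 ab).
have : 4 * d * 1 <= 4 * d * (d * g ^+ 2) by rewrite ler_pM2l // mulr_gt0.
have : 0 <= d * (d * g ^+ 2) by rewrite !mulr_ge0 // ltW.
have -> : 2 * (3 * d) ^+ 2 * (97 / 100 * g ^+ 2) = 1746 / 100 * (d * (d * g ^+ 2)).
  by field.
lra.
Qed.

Lemma hline_tight m q : hline (cycle_edge m) q ->
  [/\ H3 q, lorentz q (j m) = 0 & lorentz q (j (ordS m)) = 0].
Proof.
move=> [Hq [a [b [t [t' [[[_ [_ a1]] [_ [_ a2]]] [[_ [_ b1]] [_ [_ b2]]] qE]]]]]].
by rewrite qE !lorentz_lin a1 a2 b1 b2; split=> //; rewrite -?qE //; ring.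
Qed.

(** The constraint [j l], active at [q] but not at [p m], decides on which side
    of [q] the edge lies, namely on that of [p m]. *)
Lemma edge_side m l q z : H3 q -> lorentz q (j m) = 0 ->
  lorentz q (j (ordS m)) = 0 -> lorentz q (j l) = 0 -> X3 q != 0 ->
  lorentz (p m) (j l) < 0 ->
  hpoly s z -> lorentz z (j m) = 0 -> lorentz z (j (ordS m)) = 0 ->
  exists c, [/\ 0 <= c, z = (X3 z / X3 q) *: q + c *: p m & z <> q -> 0 < c].
Proof.
move=> Hq q1 q2 ql q3 pl Xz z1 z2.
have [c zE] := edge_span z1 z2 q1 q2 q3.
have zl : lorentz z (j l) <= 0 by case: Xz => _ /(_ _ (j_s l)) [].
have c0 : 0 <= c.
  by move: zl; rewrite zE !lorentz_lin ql mulr0 add0r; nra.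
exists c; split=> // zq; rewrite lt_neqAle c0 andbT; apply/eqP => c00.
apply: zq; apply: (H3_ray (hpoly_H3 Xz) Hq (_ : z = (X3 z / X3 q) *: q)).
by rewrite {1}zE -c00 scale0r addr0.
Qed.

(** The meeting point [q] of the two lines lies on the three planes of
    consecutive faces, so it is not in the middle plane.  A vertex of the edge on
    the same side of that plane lies between the plane and [q], hence [q] is also
    beyond the gap, and [thin_angle] applies to the directions from [q] to the
    two corners. *)
Lemma curvature_contribution_le m :
  curvature_contribution (cycle_edge (ord_pred m)) (cycle_edge m) <= 18 * delta ^+ 2.
Proof.
rewrite /curvature_contribution; case: xgetP => [t _ |]; last first.
  by move=> _; rewrite mulr_ge0 // sqr_ge0.
case=> q [a [b [[/hline_tight[Hq q0 q1] /hline_tight[_ _ q2]] [ea aq] [eb bq] ->]]].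
rewrite ord_predK in q1.
have fq := H3_future Hq.
have q3 : X3 q != 0.
  apply/eqP => q3; have qE := corner_span q1 q2 q3.
  have := q0; rewrite qE lorentzZl => /eqP; rewrite mulf_eq0.
  by rewrite (gt_eqF (X0_future_gt0 fq)) (lt_eqF (p_next_lt0 m)).
have [[Xa [_ a0]] [_ [_ a1]]] := ea; rewrite ord_predK in a1.
have [[Xb [_ b1]] [_ [_ b2]]] := eb.
have P1 : lorentz q (j (ordS (ord_pred m))) = 0 by rewrite ord_predK.
have P2 : lorentz a (j (ordS (ord_pred m))) = 0 by rewrite ord_predK.
have [c [_ aE /(_ aq) c0]] := edge_side Hq q0 P1 q2 q3 (p_pred_lt0 m) Xa a0 P2.
have [c' [_ bE /(_ bq) c'0]] := edge_side Hq q1 q2 q0 q3 (p_next_lt0 m) Xb b1 b2.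
rewrite (hangle_proj Hq c0 c'0 aE bE).
apply: thin_angle; rewrite ?p_X0 ?p_X3 //.
have [i ui h] := far_vertex (p_hcone m) (p_X3 m) q3.
have u1 : lorentz (u i) (j m) = 0 by apply: h; rewrite ?p_l.
have u2 : lorentz (u i) (j (ordS m)) = 0 by apply: h; rewrite ?p_r.
have [e [e0 uE _]] := edge_side Hq q1 q2 q0 q3 (p_next_lt0 m) (u_hpoly i) u1 u2.
set la := X3 (u i) / X3 q in uE.
have la0 : 0 < la.
  rewrite /la -(pmulr_lgt0 _ (exprn_gt0 2 (_ : 0 < `|X3 q|))) ?normr_gt0 //.
  by rewrite real_normK ?num_real // expr2 mulrA divfK // mulrC.
have u0E : X0 (u i) = la * X0 q + e by rewrite {1}uE !lorentz_lin p_f0; ring.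
have u3E : X3 (u i) = la * X3 q by rewrite /la divfK.
have qp := X0_future_gt0 fq.
have := u_far i; rewrite u0E u3E exprMn => far.
rewrite -(ler_pM2l (exprn_gt0 2 la0)); apply: le_trans far.
rewrite mulrCA -exprMn ler_wpM2l //; first by have := delta2_small; lra.
by rewrite ler_sqr ?nnegrE; have := mulr_gt0 la0 qp; lra.
Qed.

(** An edge of the cycle is determined by a vertex on either side of the middle
    plane, since these two points span the line of the edge. *)
Lemma cycle_length : (k <= #|I| * #|I|)%N.
Proof.
have [g gP] : {g : 'I_k -> I * I & forall m,
    [/\ X3 (u (g m).1) < 0, 0 < X3 (u (g m).2),
        lorentz (u (g m).1) (j m) = 0 /\ lorentz (u (g m).1) (j (ordS m)) = 0 &
        lorentz (u (g m).2) (j m) = 0 /\ lorentz (u (g m).2) (j (ordS m)) = 0]}.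
  apply: (@choice _ _ (fun m (g : I * I) =>
    [/\ X3 (u g.1) < 0, 0 < X3 (u g.2),
        lorentz (u g.1) (j m) = 0 /\ lorentz (u g.1) (j (ordS m)) = 0 &
        lorentz (u g.2) (j m) = 0 /\ lorentz (u g.2) (j (ordS m)) = 0])) => m.
  have N1 : -1 != 0 :> R by rewrite oppr_eq0 oner_eq0.
  have [i ui h] := far_vertex (p_hcone m) (p_X3 m) N1.
  have [i' ui' h'] := right_vertex m.
  exists (i, i'); split=> //=; first by move: ui; rewrite mulN1r oppr_gt0.
  by split; apply: h; rewrite // ?p_l ?p_r.
suff ginj : injective g.
  by have := leq_card g ginj; rewrite card_ord card_prod.
have pE m m' : g m = g m' -> p m = p m'.
  move=> gm; have [n1 n2 [n3 n4] [n5 n6]] := gP m.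
  have [_ _] := gP m'; rewrite -gm => -[n3' n4'] [n5' n6'].
  pose z := X3 (u (g m).2) *: u (g m).1 - X3 (u (g m).1) *: u (g m).2.
  have z3 : X3 z = 0 by rewrite /z !lorentz_lin; ring.
  have z0 : 0 < X0 z.
    apply: X0_future_gt0; rewrite /z -scaleNr; apply: future_add.
      by apply: future_scale => //; exact: u_future.
    by apply: future_scale; rewrite ?oppr_gt0 //; exact: u_future.
  have zE : z = X0 z *: p m.
    by apply: corner_span => //; rewrite /z !lorentz_lin ?n3 ?n4 ?n5 ?n6; ring.
  have zE' : z = X0 z *: p m'.
    by apply: corner_span => //; rewrite /z !lorentz_lin ?n3' ?n4' ?n5' ?n6'; ring.
  apply: (scalerI (lt0r_neq0 z0)); by rewrite -zE -zE'.
move=> m m' /pE pm.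
have : lorentz (p m') (j m) = 0 by rewrite -pm.
move/p_tight => [//|mS].
have : lorentz (p m) (j m') = 0 by rewrite pm.
move/p_tight => [//|mS'].
by have := ordSS_neq m k_gt2; rewrite -mS' -mS eqxx.
Qed.

End Cycle.

Lemma slab_cycle : exists (k : nat) (F e : 'I_k -> set V),
  [/\ gauss_curve (hpoly s) F e, (k <= #|I| * #|I|)%N,
      \sum_(m < k) exterior_dihedral (hpoly s) (e m) <= 2 * pi + k%:R * (30 * delta) &
      geodesic_curvature e <= k%:R * (18 * delta ^+ 2)].
Proof.
pose n (i : 'I_(size s)) := nth 0 s i.
have ns i : n i \in s by rewrite mem_nth.
have nP l : l \in s -> exists i, n i = l.
  by move=> /(nthP 0)[i lt <-]; exists (Ordinal lt).
have int : exists a b, forall i, X1 (n i) * a + X2 (n i) * b < X0 (n i).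
  by have [a [b [_ ab]]] := section_interior; exists a, b => i; exact: ab.
have bnd v w : (v, w) != (0, 0) -> exists i, 0 < X1 (n i) * v + X2 (n i) * w.
  by move=> /section_bounded[l /nP[i <-]]; exists i.
have [k [j [x [y [D [[k2 _] side feas tight sumD]]]]]] :=
  @polygon_cycle R _ (fun i => X1 (n i)) (fun i => X2 (n i)) (fun i => X0 (n i)) int bnd.
pose p m := pt (x m) (y m).
have nj m : n (j m) \in s by [].
have D0 m : 0 < D m by case: (side m).
have Dpi m : D m < pi by case: (side m).
have det0 m : 0 < X1 (n (j m)) * X2 (n (j (ordS m))) - X1 (n (j (ordS m))) * X2 (n (j m)).
  by case: (side m).
have Dcos m : X1 (n (j m)) * X1 (n (j (ordS m))) + X2 (n (j m)) * X2 (n (j (ordS m))) =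
    Num.sqrt (X1 (n (j m)) ^+ 2 + X2 (n (j m)) ^+ 2) *
    Num.sqrt (X1 (n (j (ordS m))) ^+ 2 + X2 (n (j (ordS m))) ^+ 2) * cos (D m).
  by case: (side m).
have p_hcone m : hcone s (p m).
  by apply: feasible_hcone => l /nP[i <-]; exact: feas.
have p0 m : X0 (p m) = 1 by have [] := pt_coord (x m) (y m).
have p3 m : X3 (p m) = 0 by have [] := pt_coord (x m) (y m).
have p_tight m l : lorentz (p m) (n (j l)) = 0 <-> l = m \/ l = ordS m.
  rewrite /p lorentz_pt -tight; split=> h; last by rewrite h subrr.
  by apply/eqP; rewrite -subr_eq0 h.
exists k, (cycle_face (fun m => n (j m))), (cycle_edge (fun m => n (j m))); split.
- exact: (cycle_gauss_curve k2 nj det0 p_hcone p0 p3 p_tight).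
- exact: (cycle_length k2 nj det0 p_hcone p0 p3 p_tight).
- rewrite -sumD; apply: le_trans (_ : \sum_m (D m + 30 * delta) <= _).
    apply: ler_sum => m _.
    exact: (exterior_dihedral_le k2 nj D0 Dpi det0 Dcos p_hcone p0 p3 p_tight).
  by rewrite big_split /= lerD2l sumr_const card_ord -[leLHS]mulr_natl.
- apply: le_trans (_ : \sum_(m < k) 18 * delta ^+ 2 <= _).
    apply: ler_sum => m _.
    exact: (curvature_contribution_le k2 nj det0 p_hcone p0 p3 p_tight).
  by rewrite sumr_const card_ord -[leLHS]mulr_natl.
Qed.

End Slab.

(** * The diameter and the final estimate *)

Section Diameter.
Variable R : realType.
Local Notation V := 'rV[R]_4.

Lemma hdist_mono (x y z w : V) : 1 <= - lorentz x y -> - lorentz x y <= - lorentz z w ->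
  hdist x y <= hdist z w.
Proof.
rewrite /hdist; set a := - _; set b := - _ => a1 ab.
have sa := sqrtr_ge0 (a ^+ 2 - 1); have sb := sqrtr_ge0 (b ^+ 2 - 1).
rewrite ler_ln ?posrE; [|lra|lra]; apply: lerD => //; apply: ler_wsqrtr.
by rewrite lerB // ler_sqr ?nnegrE; lra.
Qed.

(** The function [- lorentz x y] is bilinear, so on convex combinations it is
    bounded by its values at pairs of vertices. *)
Lemma hdiam_vertices (I : finType) (v : I -> V) (X : set V) : X `<=` @H3 R ->
  X !=set0 -> (forall i, H3 (v i)) -> (forall x, X x -> cone_of v x) ->
  exists i j, hdiam X <= hdist (v i) (v j).
Proof.
move=> XH [x0 Xx0] Hv Xv.
have [i0] : exists i : I, True.
  apply: contrapT => none; have [c _ xE] := Xv _ Xx0.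
  have := future_neq0 (H3_future (XH _ Xx0)); rewrite xE big1 ?eqxx // => i.
  by case: none; exists i.
move=> _; pose g (q : I * I) := - lorentz (v q.1) (v q.2).
case: (@Order.TotalTheory.arg_maxP _ _ _ (i0, i0) xpredT g isT) => -[i j] _ gmax.
have g1 q : 1 <= g q by rewrite /g; have := H3_le (Hv q.1) (Hv q.2); lra.
exists i, j; apply: ge_sup.
  by exists (hdist x0 x0), x0, x0.
move=> _ [x [y [Xx Xy ->]]].
apply: hdist_mono; first by have := H3_le (XH _ Xx) (XH _ Xy); lra.
have expand (c d : I -> R) : - lorentz (\sum_i c i *: v i) (\sum_i d i *: v i) =
    \sum_i \sum_l c i * d l * g (i, l).
  rewrite lorentz_suml -sumrN; apply: eq_bigr => a _.
  rewrite lorentzZl lorentzC lorentz_suml mulr_sumr -sumrN; apply: eq_bigr => b _.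
  by rewrite lorentzZl lorentzC /g /=; ring.
have sum2 (c d : I -> R) : \sum_i \sum_l c i * d l = (\sum_i c i) * (\sum_l d l).
  by rewrite mulr_suml; apply: eq_bigr => a _; rewrite mulr_sumr.
(* The coefficients of a point of hyperbolic space add up to at most one, by
   the reverse triangle inequality. *)
have sum_le1 (c : I -> R) z : H3 z -> (forall i, 0 <= c i) -> z = \sum_i c i *: v i ->
    \sum_i c i <= 1.
  move=> [zz _] c0 zE; have sc : 0 <= \sum_i c i by exact: sumr_ge0.
  rewrite -ler_sqr ?nnegrE // expr1n expr2 -sum2 -[leRHS]opprK -zz zE expand.
  apply: ler_sum => a _; apply: ler_sum => b _; rewrite -[leLHS]mulr1.
  by rewrite ler_wpM2l // mulr_ge0.
have [c c0 xE] := Xv _ Xx; have [d d0 yE] := Xv _ Xy.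
have c1 := sum_le1 c x (XH _ Xx) c0 xE; have d1 := sum_le1 d y (XH _ Xy) d0 yE.
rewrite xE yE expand; apply: le_trans (_ : \sum_a \sum_b c a * d b * g (i, j) <= _).
  apply: ler_sum => a _; apply: ler_sum => b _.
  by rewrite ler_wpM2l ?mulr_ge0 //; exact: gmax.
under eq_bigr do rewrite -mulr_suml.
rewrite -mulr_suml sum2 -/(g (i, j)) -[leRHS]mul1r ler_wpM2r //.
  by apply: le_trans (g1 (i, j)).
by rewrite -[leRHS]mul1r ler_pM // sumr_ge0.
Qed.

End Diameter.

(** The factor gained from [n] gaps instead of [n.+1] is
    [exp (- rho / (2 n (n + 1)))], which is small for large [rho]. *)
Lemma gap_scale (R : realType) (n : nat) (rho : R) : (0 < n)%N ->
  40 * n.+1%:R ^+ 3 < rho ->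
  exists2 x : R, 0 < x < (20 * n.+1%:R)^-1 &
    expR (- (rho / (2 * n%:R))) = expR (- (rho / (2 * n.+1%:R))) * x.
Proof.
move=> n0 rho0; pose t := rho / (2 * n%:R * n.+1%:R).
have nR : 0 < n%:R :> R by rewrite ltr0n.
have NE : n.+1%:R = n%:R + 1 :> R by rewrite -natr1.
have NR : 0 < n.+1%:R :> R by rewrite ltr0n.
have tN : 20 * n.+1%:R < t.
  rewrite /t ltr_pdivlMr ?mulr_gt0 //; apply: le_lt_trans rho0.
  rewrite NE in NR *; rewrite !exprS expr0; nra.
exists (expR (- t)).
  rewrite expR_gt0 expRN ltf_pV2 ?posrE ?expR_gt0 ?mulr_gt0 //.
  apply: (lt_le_trans tN); apply: le_trans (expR_ge1Dx t); lra.
rewrite -expRD; congr expR; rewrite /t NE; field.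
by rewrite -NE !gt_eqF.
Qed.

Theorem theorem10 (R : realType) (N : nat) :
  exists rho0 : R,
  forall (X : set 'rV[R]_4) (rho : R),
    convex_polyhedron X ->
    (vertices X #= `I_N)%card ->
    hdiam X = rho ->
    rho0 < rho ->
    exists (k : nat) (F e : 'I_k -> set 'rV[R]_4),
      [/\ gauss_curve X F e,
          \sum_(i < k) exterior_dihedral X (e i)
            < 2 * pi + 12 * N%:R * expR (- (rho / (2 * N%:R)))
        & geodesic_curvature e <= 3 * k%:R * expR (- (rho / N%:R))].
Proof.
exists (40 * N%:R ^+ 3) => X rho [[s [s1 ->]] cX [q [r [Hq r0 ball]]]] cardX Xrho rho0.
rewrite -/(hpoly s) in cX ball cardX Xrho *.
have qX : hpoly s q.
  apply: ball => //; case: Hq => qq _.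
  by rewrite /hdist qq opprK expr1n subrr sqrtr0 addr0 ln1.
have qint := hpoly_interior s1 Hq r0 ball.
have fq := H3_future Hq.
rewrite card_eq_sym in cardX; have /card_set_bijP[f [fI _ fsurj]] := cardX.
pose u (i : 'I_N) := f i.
have uX i : hpoly s (u i).
  have [[m [_ _ mE]] _] := fI i (ltn_ord i).
  by have : [set f i] (f i) by []; rewrite mE => -[].
have usurj z : vertices (hpoly s) z -> exists i, u i = z.
  by move=> /fsurj[i iN <-]; exists (Ordinal iN).
have uspan := hcone_cone_of cX qint usurj.
have [|i [j ij]] := @hdiam_vertices R _ u (hpoly s) (@hpoly_H3 _ s) _
    (fun i => hpoly_H3 (uX i)) (fun x Xx => uspan x (hpoly_hcone Xx)); first by exists q.
rewrite Xrho in ij.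
clearbody u; clear - rho0 s1 fq qint uX uspan ij.
case: N rho0 u uX uspan i j ij => [|n] rho0 u uX uspan i j ij; first by case: i {ij}.
have rho_gt0 : 0 < rho.
  by apply: le_lt_trans rho0; rewrite mulr_ge0 // exprn_ge0.
have [f0 [f3 [[F0 f00] f33 f03 gap [left right]]]] :=
  axis_gap (fun i => hpoly_H3 (uX i)) rho_gt0 ij.
have [f1 [f2 [[f11 f22] f12 [f01 f02] [f31 f32] frame]]] :=
  orthonormal_frame F0 f00 f33 f03.
have n0 : (0 < n)%N.
  rewrite lt0n; apply: contraTneq left => nE; rewrite -leNgt.
  have -> : i = j by apply: ord_inj; move: (ltn_ord i) (ltn_ord j); clear - nE; lia.
  exact: ltW.
have nR : n%:R != 0 :> R by rewrite pnatr_eq0 -lt0n.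
have [x /andP[x0 x1] xE] := gap_scale n0 rho0.
set E := expR (- (rho / (2 * n.+1%:R))) in xE *.
have E0 : 0 < E by exact: expR_gt0.
have NR : 1 <= n.+1%:R :> R by rewrite ler1n.
have xN : x * (20 * n.+1%:R) < 1.
  by rewrite -ltr_pdivlMr ?div1r // mulr_gt0 // (lt_le_trans ltr01).
have x20 : x <= 20^-1 by nra.
have E1 : E <= 1.
  by rewrite -expR0 ler_expR oppr_le0 divr_ge0 ?(ltW rho_gt0) // mulr_ge0.
(* With [w = exp (rho / n)], the width satisfies [delta ^+ 2 = 4 / w]. *)
pose delta := 2 * (E * x).
have d0 : 0 < delta by rewrite !mulr_gt0.
have d10 : delta <= 10^-1 by rewrite /delta; nra.
have far l : (1 - delta ^+ 2) * (- lorentz (u l) f0) ^+ 2 <= lorentz (u l) f3 ^+ 2.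
  have := gap l => /=; set w := expR _ => gl.
  have w1 : 1 < w by rewrite expR_gt1 divr_gt0 // lt_neqAle eq_sym nR ler0n.
  have dw : delta ^+ 2 * w = 4.
    rewrite /delta -xE exprMn -expRM_natl /w -mulrA -expRD.
    have -> : 2 * - (rho / (2 * n%:R)) + rho / n%:R = 0 by field.
    by rewrite expR0; ring.
  have h0 : 0 < - lorentz (u l) f0.
    by apply: X0_future_gt0 => //; apply/H3_future/hpoly_H3/uX.
  have : ((w - 1) * - lorentz (u l) f0) ^+ 2 <= ((w + 1) * `|lorentz (u l) f3|) ^+ 2.
    rewrite ler_sqr ?nnegrE // mulr_ge0 ?normr_ge0 //; lra.
  rewrite [leLHS]exprMn [leRHS]exprMn real_normK ?num_real // => h.
  have w2 : 0 < (w + 1) ^+ 2 by rewrite exprn_gt0 //; lra.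
  rewrite -(ler_pM2l w2); apply: le_trans h; rewrite [leLHS]mulrA.
  apply: ler_wpM2r; first exact: sqr_ge0.
  have -> : (w + 1) ^+ 2 * (1 - delta ^+ 2) = (w + 1) ^+ 2 -
    (delta ^+ 2 * w * (w + 2) + delta ^+ 2) by ring.
  by rewrite dw; have := sqr_ge0 delta; rewrite !expr2; nra.
have [k [F [e [gc kI ext curv]]]] :=
  slab_cycle F0 f00 f11 f22 f12 f01 f02 f03 f31 f32 frame s1 fq qint uX uspan
    d0 d10 far left right.
rewrite card_ord in kI.
have kN : k%:R <= n.+1%:R ^+ 2 :> R by rewrite -natrX ler_nat expnS expn1.
exists k, F, e; split=> //.
- apply: (le_lt_trans ext); rewrite ltrD2l /delta.
  have : k%:R * (E * x) <= n.+1%:R ^+ 2 * (E * x) by rewrite ler_wpM2r // ltW // mulr_gt0.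
  have NE0 : 0 < n.+1%:R * E by rewrite mulr_gt0 // (lt_le_trans ltr01).
  have : n.+1%:R * E * (x * (20 * n.+1%:R)) < n.+1%:R * E * 1 by rewrite ltr_pM2l.
  rewrite !expr2; lra.
- apply: (le_trans curv).
  have -> : expR (- (rho / n.+1%:R)) = E ^+ 2.
    rewrite -expRM_natl; congr expR; field.
    by apply: lt0r_neq0; have := ler0n R n; lra.
  have : k%:R * E ^+ 2 * x ^+ 2 <= k%:R * E ^+ 2 * (20^-1) ^+ 2.
    apply: ler_wpM2l; first by rewrite mulr_ge0 ?sqr_ge0.
    by rewrite ler_sqr ?nnegrE ?(ltW x0) ?invr_ge0.
  have : 0 <= k%:R * E ^+ 2 by rewrite mulr_ge0 // sqr_ge0.
  rewrite /delta exprVn !expr2; lra.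
Qed.
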